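(* Let $\varepsilon$ be any positive rational number, and let $k$ and $h$ be positive constants. If a computational puzzle can be solved in time $n^k$ and space $n^h$, where $n$ is the size of the input, then it has an $(O(1),\, n^{h+\varepsilon},\, \log n)$-verification game; that is, it has a verification game with $O(1)$ rounds, in which the players can write up to $O(n^{h+\varepsilon})$ bits of information in every round, and in which a miner spends up to $\mathrm{poly}(\log n)$ time for verifying each step.
   Context: Computational puzzle. A computational puzzle is a computational task: given an input of size $n$, produce a correct solution for that input. It can be solved in time $n^k$ and space $n^h$ if some algorithm, on inputs of size $n$, produces a correct solution within time $n^k$ and space $n^h$. The statement does not fix a particular model of computation for this algorithm (one may, without loss of generality, think of a Turing machine). Verification game. A prover submits a proposed solution $S$ to the puzzle on a given input. A verification game is a finite interaction, with predefined rules, between the prover, who defends $S$, and a challenger, who disputes $S$. The players write their messages on a block chain, or on a publicly readable board where they cannot be altered. The miners (the participants of the network) verify that both players stick to the rules and determine the winner, who is one of the two players. The purpose of the game is to decide whether $S$ is correct: if $S$ is a correct solution, the prover has a winning strategy, and if $S$ is not a correct solution, the challenger has a winning strategy. In any verification game the computations of both the prover and the challenger run in time polynomial in the size $n$ of the input. For functions $F,G,H$ of the input size $n$, an $(F,G,H)$-verification game is a verification game that consists of (i) $F(n)$ rounds, where (ii) the players can write up to $O(G(n))$ bits of information in every round, and (iii) a miner in the network spends up to $\mathrm{poly}(H(n))$ time for verifying each step. Here the miner's time is measured for random access computation, so a miner need not read the full information provided in a round but only the relevant parts needed for verification. $F=O(1)$ means that the number of rounds is bounded by a constant not depending on $n$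 (it may depend on $k$, $h$, $\varepsilon$), and $\mathrm{poly}(H(n))$ means bounded by a polynomial in $H(n)$.
   Formalization: Each input of the puzzle is taken to have exactly one correct solution; if several solutions may be correct, an algorithm that finds one says nothing about the others, whose correctness may be undecidable, and the claim fails. *)

(* Defs.v *)
From HB Require Import structures.
From mathcomp Require Import all_boot all_order all_algebra.
From mathcomp Require Import all_classical all_reals all_analysis.
Set Implicit Arguments.
Unset Strict Implicit.
Unset Printing Implicit Defensive.
Import Order.TTheory GRing.Theory Num.Theory.
Import numFieldNormedType.Exports.
Local Open Scope classical_set_scope.
Local Open Scope ring_scope.

(* [f = O(g)] as [n] tends to infinity, for a natural-valued [f]. *)
Definition isO (R : realType) (f : nat -> nat) (g : nat -> R) : Prop :=
  (fun n => (f n)%:R : R^o) =O_\oo (g : nat -> R^o).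

(** * Puzzles and their solution by Turing machines *)

(* A puzzle maps each input to its correct solution. Uniqueness is essential:
   were an arbitrary relation allowed, an algorithm producing one correct
   solution would say nothing about the correctness of the others, which could
   then even be undecidable. *)
Definition puzzle := seq bool -> seq bool.

Definition correct (f : puzzle) (x S : seq bool) : Prop := S = f x.

(* Off-line Turing machines: a two-way read-only input tape with end markers,
   a one-way infinite read-write work tape, and an append-only output tape.
   Only the work tape counts as space, so sublinear space is meaningful. *)
Inductive input_symbol := LeftEnd | RightEnd | InputBit of bool.

Inductive direction := MoveLeft | Stay | MoveRight.

Definition move (d : direction) (p : nat) : nat :=
  match d with MoveLeft => p.-1 | Stay => p | MoveRight => p.+1 end.

Record TM := MkTM {
  tm_state : finType;
  tm_symbol : finType;
  tm_start : tm_state;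
  tm_blank : tm_symbol;
  (* [None] means halting; otherwise: next state, input head move, symbol
     written on the work tape, work head move, and bit output, if any *)
  tm_delta : tm_state -> input_symbol -> tm_symbol ->
    option (tm_state * direction * tm_symbol * direction * option bool) }.

(* The work tape holds [tm_blank M] beyond the end of [cf_tape]. *)
Record config (M : TM) := MkConfig {
  cf_state : tm_state M;
  cf_input_pos : nat;
  cf_work_pos : nat;
  cf_tape : seq (tm_symbol M);
  cf_output : seq bool }.

(* Input cells: the left marker at 0, [x] at 1, ..., size x, then the right
   marker, beyond which the input head does not move. *)
Definition read_input (x : seq bool) (p : nat) : input_symbol :=
  if p is q.+1 then
    if onth x q is Some b then InputBit b else RightEnd
  else LeftEnd.

Definition tm_init (M : TM) : config M :=
  MkConfig (tm_start M) 0 0 [::] [::].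

Definition tm_next (M : TM) (x : seq bool) (c : config M) :=
  tm_delta (cf_state c) (read_input x (cf_input_pos c))
    (nth (tm_blank M) (cf_tape c) (cf_work_pos c)).

Definition tm_step (M : TM) (x : seq bool) (c : config M) : config M :=
  if tm_next x c is Some (q, di, a, dw, ob) then
    MkConfig q
      (minn (move di (cf_input_pos c)) (size x).+1)
      (move dw (cf_work_pos c))
      (set_nth (tm_blank M) (cf_tape c) (cf_work_pos c) a)
      (cf_output c ++ (if ob is Some b then [:: b] else [::]))
  else c.

Definition tm_run (M : TM) (x : seq bool) (i : nat) : config M :=
  iter i (tm_step x) (tm_init M).

(* On input [x], [M] halts with output [y] after at most [t] steps, during
   which it only visits the first [s] cells of its work tape. *)
Definition tm_computes (M : TM) (x y : seq bool) (t s : nat) : Prop :=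
  exists i : nat,
    [/\ (i <= t)%N,
        tm_next x (tm_run M x i) = None,
        cf_output (tm_run M x i) = y &
        forall j : nat, (j <= i)%N -> (cf_work_pos (tm_run M x j) < s)%N].

(* As usual for machine-independent bounds, the time and the space are
   understood up to constant factors. *)
Definition solvable (R : realType) (f : puzzle) (T Sp : nat -> R) : Prop :=
  exists (M : TM) (t s : nat -> nat),
    [/\ isO t T, isO s Sp &
        forall x, tm_computes M x (f x) (t (size x)) (s (size x))].

(** * Random access computation *)

(* Structured programs for a random access machine with registers, a memory
   and read-only random access to a board, which is a sequence of bit strings.
   There is no multiplication: in [t] units of time, numbers of only O(t) more
   bits than the initial ones can be built, so that charging a unit per
   operation is polynomially equivalent to charging for bit lengths. *)
Inductive expr :=
  | ELit of nat
  | EReg of nat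
  | EAdd of expr & expr
  | ESub of expr & expr
  | EHalf of expr
  | ELoad of expr
  | ERead of expr & expr.

Inductive prog :=
  | PSkip
  | PSet of nat & expr
  | PStore of expr & expr
  | PEmit of expr
  | PSeq of prog & prog
  | PIf of expr & prog & prog
  | PWhile of expr & prog.

Record ram := MkRam {
  ram_reg : nat -> nat;
  ram_mem : nat -> nat;
  ram_out : seq bool }.

Definition upd (m : nat -> nat) (a v : nat) : nat -> nat :=
  fun b => if b == a then v else m b.

(* The value 2 signals a position past the end of a board entry. *)
Definition board_read (board : seq (seq bool)) (i j : nat) : nat :=
  if onth (nth [::] board i) j is Some b then nat_of_bool b else 2%N.

Fixpoint ram_eval (board : seq (seq bool)) (s : ram) (e : expr) : nat :=
  match e with
  | ELit v => v
  | EReg r => ram_reg s r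
  | EAdd e1 e2 => (ram_eval board s e1 + ram_eval board s e2)%N
  | ESub e1 e2 => (ram_eval board s e1 - ram_eval board s e2)%N
  | EHalf e1 => (ram_eval board s e1)./2
  | ELoad e1 => ram_mem s (ram_eval board s e1)
  | ERead e1 e2 => board_read board (ram_eval board s e1) (ram_eval board s e2)
  end.

Fixpoint ecost (e : expr) : nat :=
  match e with
  | ELit _ | EReg _ => 1
  | EAdd e1 e2 | ESub e1 e2 | ERead e1 e2 => (ecost e1 + ecost e2).+1
  | EHalf e1 | ELoad e1 => (ecost e1).+1
  end%N.

(* [exec board p s t s']: started in [s], [p] terminates in [s'] after [t]
   units of time. *)
Inductive exec (board : seq (seq bool)) : prog -> ram -> nat -> ram -> Prop :=
  | ExecSkip s :
      exec board PSkip s 1 s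
  | ExecSet r e s :
      exec board (PSet r e) s (ecost e).+1
        (MkRam (upd (ram_reg s) r (ram_eval board s e)) (ram_mem s) (ram_out s))
  | ExecStore e1 e2 s :
      exec board (PStore e1 e2) s (ecost e1 + ecost e2).+1
        (MkRam (ram_reg s)
           (upd (ram_mem s) (ram_eval board s e1) (ram_eval board s e2))
           (ram_out s))
  | ExecEmit e s :
      exec board (PEmit e) s (ecost e).+1
        (MkRam (ram_reg s) (ram_mem s)
           (rcons (ram_out s) (ram_eval board s e != 0%N)))
  | ExecSeq p1 p2 s t1 s1 t2 s2 :
      exec board p1 s t1 s1 -> exec board p2 s1 t2 s2 ->
      exec board (PSeq p1 p2) s (t1 + t2)%N s2
  | ExecIfTrue e p1 p2 s t s' :
      ram_eval board s e <> 0%N -> exec board p1 s t s' ->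
      exec board (PIf e p1 p2) s ((ecost e).+1 + t)%N s'
  | ExecIfFalse e p1 p2 s t s' :
      ram_eval board s e = 0%N -> exec board p2 s t s' ->
      exec board (PIf e p1 p2) s ((ecost e).+1 + t)%N s'
  | ExecWhileStop e p s :
      ram_eval board s e = 0%N -> exec board (PWhile e p) s (ecost e).+1 s
  | ExecWhileLoop e p s t1 s1 t2 s2 :
      ram_eval board s e <> 0%N ->
      exec board p s t1 s1 -> exec board (PWhile e p) s1 t2 s2 ->
      exec board (PWhile e p) s ((ecost e).+1 + t1 + t2)%N s2.

(** * Verification games *)

Inductive player := Prover | Challenger.

(* The [i]-th message, counting from 0: in every round, first the prover and
   then the challenger writes a (possibly empty) message. *)
Definition mover (i : nat) : player := if odd i then Challenger else Prover.

(* A message as a function of the input, of the proposed solution, and of the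
   messages already on the board. *)
Definition strategy := seq bool -> seq bool -> seq (seq bool) -> seq bool.

(* [vg_verdict x S msgs] is the decision of the miners after the last message
   of [msgs] has been written: the winner, or [None] if the game goes on. *)
Record game := MkGame {
  vg_rounds : nat -> nat;
  vg_limit : nat -> nat;
  vg_verdict : seq bool -> seq bool -> seq (seq bool) -> option player }.

Definition legal (g : game) (n : nat) (msgs : seq (seq bool)) : Prop :=
  (size msgs <= 2 * vg_rounds g n)%N /\
  all (fun m => size m <= vg_limit g n)%N msgs.

Definition legal_strategy (g : game) (s : strategy) : Prop :=
  forall x S msgs, (size (s x S msgs) <= vg_limit g (size x))%N.

Fixpoint play (P C : strategy) (x S : seq bool) (i : nat) : seq (seq bool) :=
  if i is j.+1 then
    let msgs := play P C x S j in
    rcons msgs (if mover j is Prover then P x S msgs else C x S msgs)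
  else [::].

(* The first decision taken by the miners, if any. *)
Definition winner (g : game) (x S : seq bool) (msgs : seq (seq bool)) :
    option player :=
  ohead (pmap (fun i => vg_verdict g x S (take i msgs)) (iota 1 (size msgs))).

Definition outcome (g : game) (P C : strategy) (x S : seq bool) :
    option player :=
  winner g x S (play P C x S (2 * vg_rounds g (size x))).

Definition prover_wins_with (g : game) (P : strategy) (x S : seq bool) : Prop :=
  forall C, legal_strategy g C -> outcome g P C x S = Some Prover.

Definition challenger_wins_with (g : game) (C : strategy) (x S : seq bool) :
    Prop :=
  forall P, legal_strategy g P -> outcome g P C x S = Some Challenger.

(* The board consists of the input, the proposed solution and the messages;
   the size of the input and the number of messages are initially in the
   registers 0 and 1. *)
Definition board_of (x S : seq bool) (msgs : seq (seq bool)) :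
    seq (seq bool) := x :: S :: msgs.

Definition ram_init (x : seq bool) (msgs : seq (seq bool)) : ram :=
  MkRam (upd (upd (fun=> 0%N) 0 (size x)) 1 (size msgs)) (fun=> 0%N) [::].

Definition ram_computes (p : prog) (x S : seq bool) (msgs : seq (seq bool))
    (out : seq bool) (t : nat) : Prop :=
  exists s : ram,
    exec (board_of x S msgs) p (ram_init x msgs) t s /\ ram_out s = out.

Definition encode_verdict (v : option player) : seq bool :=
  match v with
  | None => [::]
  | Some Prover => [:: true]
  | Some Challenger => [:: false]
  end.

Definition poly_time_player (R : realType) (g : game) (pl : player)
    (s : strategy) : Prop :=
  exists (p : prog) (q : {poly R}),
    forall x S msgs, legal g (size x) msgs -> mover (size msgs) = pl ->
      exists t : nat,
        ram_computes p x S msgs (s x S msgs) t /\ t%:R <= q.[(size x)%:R].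

Definition miner_time (R : realType) (g : game) (H : nat -> R) : Prop :=
  exists (p : prog) (q : {poly R}),
    forall x S msgs, legal g (size x) msgs -> (0 < size msgs)%N ->
      exists t : nat,
        ram_computes p x S msgs (encode_verdict (vg_verdict g x S msgs)) t /\
        t%:R <= q.[H (size x)].

(* A winner is always determined, and whichever player is right about the
   proposed solution has a winning strategy running in polynomial time. The
   opponent is not computationally bounded. *)
Definition verification_game (R : realType) (f : puzzle) (g : game) : Prop :=
  (forall x S msgs, legal g (size x) msgs ->
     size msgs = (2 * vg_rounds g (size x))%N -> winner g x S msgs <> None) /\
  exists P C : strategy,
    [/\ legal_strategy g P /\ poly_time_player R g Prover P,
        legal_strategy g C /\ poly_time_player R g Challenger C,
        forall x S, correct f x S -> prover_wins_with g P x S &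
        forall x S, ~ correct f x S -> challenger_wins_with g C x S].

Definition FGH_verification_game (R : realType) (f : puzzle) (F : nat -> nat)
    (G H : nat -> R) (g : game) : Prop :=
  [/\ verification_game R f g,
      forall n, vg_rounds g n = F n,
      isO (vg_limit g) G &
      miner_time g H].

(* Main.v *)
(* The prover claims configurations of the computation of a machine [M] for the
   puzzle, and the challenger points at a false claim.

   Before the first claim, the challenger picks an index [j] at which the
   proposed solution is wrong. Configurations record the [j]-th bit of the
   output, so that a configuration takes space O(n^h log n) only, and the claim
   about the last configuration can be compared with the proposed solution in a
   single cell. In each of the next [R] rounds, the interval of time in dispute
   is divided into D = O(n^(eps/3)) intervals of the same length; the prover
   writes the configurations at their ends, and the challenger chooses the first
   interval whose right end is claimed wrongly. Hence its left end is claimed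
   correctly. After [R] rounds the interval has length 1, and the challenger
   names a cell of the right end that is wrong. The contents of this cell are
   determined by a bit of the input and a bounded number of cells of the left
   end; a miner reads nothing else, and each cell holds O(log n) bits.

   A prover who writes true configurations passes every such test. The powers of
   n are replaced by powers of 2 whose exponents are multiples of one number
   K + O(log n), which is computed by halving n repeatedly. *)
Require Import Defs.
From mathcomp Require Import all_boot all_order all_algebra.
From mathcomp Require Import all_classical all_reals all_analysis.
From mathcomp Require Import zify ring lra.
Set Implicit Arguments.
Unset Strict Implicit.
Unset Printing Implicit Defensive.
Import Order.TTheory GRing.Theory Num.Theory.
Import numFieldNormedType.Exports.

(** The unit of scale is [v], with [2 ^ v] of order [n ^ (1 / q)]. A message of the prover has (D +
    1) * B words of [L * v] bits, where B = 2 ^ (p * v) and p <= h * q + 1. Its exponent exceeds [h]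
    by at most three units of 1 / q: one from rounding [h * q] up, one from D, one from the
    logarithmic word length, which is bounded by L * 2 ^ v. This is the origin of eps / 3. Powers of
    2 are forced by the miner, who has no multiplication and time for only polylogarithmically many
    operations: an address m * B + a is formed by doubling. The format of messages is not policed.
    Every string denotes words, pointers are clamped to their range, and a step of the machine is
    extended to arbitrary codes, so every play has a verdict. An end shared with the interval of the
    previous round is looked up where it was claimed before, so the prover cannot restate it.
    Players and miner are verified and timed by one calculus, in which only the bound Z on the
    iterations of loops differs: [2 ^ (L * v)] for the players, [L * v] for the miner. *)

(** * Cost of programs *)

(* The cost of a program when each of its loops is executed at most [Z] times,
   each time it is entered. *)
Fixpoint pcost (Z : nat) (p : prog) : nat :=
  match p with
  | PSkip => 1
  | PSet _ e | PEmit e => (ecost e).+1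
  | PStore e1 e2 => (ecost e1 + ecost e2).+1
  | PSeq p1 p2 => pcost Z p1 + pcost Z p2
  | PIf e p1 p2 => (ecost e).+1 + (pcost Z p1 + pcost Z p2)
  | PWhile e p => (ecost e).+1 + Z * ((ecost e).+1 + pcost Z p)
  end.

(** Only loops let the cost grow with [Z], and each raises the degree by one. For a fixed program, a
    logarithmic bound on [Z] thus gives polylogarithmic time, and a polynomial bound gives
    polynomial time. *)
Lemma pcost_poly (p : prog) :
  exists C d : nat, forall Z, pcost Z p <= C * Z.+1 ^ d.
Proof.
have const c : exists C d, forall Z, c <= C * Z.+1 ^ d.
  by exists c, 0 => Z; rewrite expn0 muln1.
have add (f g : nat -> nat) :
    (exists C d, forall Z, f Z <= C * Z.+1 ^ d) ->
    (exists C d, forall Z, g Z <= C * Z.+1 ^ d) ->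
    exists C d, forall Z, f Z + g Z <= C * Z.+1 ^ d.
  move=> [C [d fC]] [C' [d' gC]]; exists (C + C'), (d + d') => Z.
  rewrite mulnDl leq_add //.
  - by apply: leq_trans (fC Z) _; rewrite leq_mul // leq_pexp2l // leq_addr.
  - by apply: leq_trans (gC Z) _; rewrite leq_mul // leq_pexp2l // leq_addl.
elim: p => /= [|r e|e1 e2|e|p1 H1 p2 H2|e p1 H1 p2 H2|e p H]; try exact: const.
- exact: (add _ _ H1 H2).
- exact: (add _ _ (const _) (add _ _ H1 H2)).
- apply: (add _ _ (const _)).
  have [C [d HC]] := add _ _ (const (ecost e).+1) H.
  exists C, d.+1 => Z; rewrite expnS mulnCA leq_mul //; exact: HC.
Qed.

Definition setr (s : ram) (r v : nat) : ram :=
  MkRam (upd (ram_reg s) r v) (ram_mem s) (ram_out s).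

(** Total correctness with a time bound, as a weakest precondition: [Q] can stand for the rest of a
    program, so that programs are verified by symbolic execution. *)
Definition wp (Z : nat) (b : seq (seq bool)) (p : prog) (s : ram)
    (Q : ram -> Prop) : Prop :=
  exists t s', [/\ exec b p s t s', t <= pcost Z p & Q s'].

Section WP.
Variables (Z : nat) (b : seq (seq bool)).
Implicit Types (p : prog) (e : expr) (s : ram) (Q : ram -> Prop).

Lemma wp_mono p s Q Q' : wp Z b p s Q -> (forall s', Q s' -> Q' s') ->
  wp Z b p s Q'.
Proof. by move=> [t [s' [ex tle Qs]]] QQ'; exists t, s'; split; auto. Qed.

Lemma wp_skip s Q : Q s -> wp Z b PSkip s Q.
Proof. by move=> Qs; exists 1, s; split=> //; exact: ExecSkip. Qed.

Lemma wp_set r e s Q : Q (setr s r (ram_eval b s e)) -> wp Z b (PSet r e) s Q.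
Proof. by move=> Qs; eexists _, _; split; [exact: ExecSet| |exact: Qs]. Qed.

Lemma wp_store e1 e2 s Q :
  Q (MkRam (ram_reg s) (upd (ram_mem s) (ram_eval b s e1) (ram_eval b s e2))
       (ram_out s)) ->
  wp Z b (PStore e1 e2) s Q.
Proof. by move=> Qs; eexists _, _; split; [exact: ExecStore| |exact: Qs]. Qed.

Lemma wp_emit e s Q :
  Q (MkRam (ram_reg s) (ram_mem s)
       (rcons (ram_out s) (ram_eval b s e != 0))) ->
  wp Z b (PEmit e) s Q.
Proof. by move=> Qs; eexists _, _; split; [exact: ExecEmit| |exact: Qs]. Qed.

Lemma wp_seq p1 p2 s Q : wp Z b p1 s (fun s1 => wp Z b p2 s1 Q) ->
  wp Z b (PSeq p1 p2) s Q.
Proof.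
move=> [t1 [s1 [ex1 t1le [t2 [s2 [ex2 t2le Qs]]]]]].
by exists (t1 + t2), s2; split=> //; [exact: ExecSeq ex2|exact: leq_add].
Qed.

Lemma wp_if e p1 p2 s Q :
  (ram_eval b s e <> 0 -> wp Z b p1 s Q) ->
  (ram_eval b s e = 0 -> wp Z b p2 s Q) ->
  wp Z b (PIf e p1 p2) s Q.
Proof.
move=> H1 H2; case: (eqVneq (ram_eval b s e) 0) => [e0|/eqP e0].
- have [t [s' [ex tle Qs]]] := H2 e0; exists ((ecost e).+1 + t), s'.
  by split=> //; [exact: ExecIfFalse|rewrite /= leq_add2l; lia].
- have [t [s' [ex tle Qs]]] := H1 e0; exists ((ecost e).+1 + t), s'.
  by split=> //; [exact: ExecIfTrue|rewrite /= leq_add2l; lia].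
Qed.

Lemma wp_while (I : nat -> ram -> Prop) (N : nat) e p s Q : N <= Z -> I 0 s ->
  (forall i s1, i < N -> I i s1 ->
     ram_eval b s1 e <> 0 /\ wp Z b p s1 (I i.+1)) ->
  (forall s1, I N s1 -> ram_eval b s1 e = 0 /\ Q s1) ->
  wp Z b (PWhile e p) s Q.
Proof.
move=> NZ I0 step last.
suff {I0 s} H k i s : k + i = N -> I i s -> exists t s',
    [/\ exec b (PWhile e p) s t s',
        t <= (ecost e).+1 + k * ((ecost e).+1 + pcost Z p) & Q s'].
  have [t [s' [ex tle Qs]]] := H N 0 s (addn0 N) I0.
  exists t, s'; split=> //; apply: leq_trans tle _.
  by rewrite /= leq_add2l leq_mul2r NZ orbT.
elim: k i s => [|k IH] i s kN Is.
  have [e0 Qs] : ram_eval b s e = 0 /\ Q s by apply: last; rewrite -kN add0n.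
  by eexists _, s; split; [exact: ExecWhileStop e0| |]; rewrite //; lia.
have iN : i < N by lia.
have [e0 [t1 [s1 [ex1 t1le Is1]]]] := step i s iN Is.
have [|t2 [s2 [ex2 t2le Qs]]] := IH i.+1 s1 _ Is1; first by lia.
eexists _, s2; split; [exact: ExecWhileLoop e0 ex1 ex2| |exact: Qs].
by rewrite mulSn; lia.
Qed.

(** The counter is decreased before the body, which therefore sees N - 1, ..., 0 and can use it as
    an index. *)
Definition Loop (c : nat) (p : prog) : prog :=
  PWhile (EReg c) (PSeq (PSet c (ESub (EReg c) (ELit 1))) p).

Lemma wp_loop (I : nat -> ram -> Prop) (N : nat) c p s Q :
  ram_reg s c = N -> N <= Z -> I 0 s ->
  (forall i s1, i < N -> I i s1 -> ram_reg s1 c = N - i ->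
     wp Z b p (setr s1 c (N - i.+1))
       (fun s2 => I i.+1 s2 /\ ram_reg s2 c = N - i.+1)) ->
  (forall s1, I N s1 -> ram_reg s1 c = 0 -> Q s1) ->
  wp Z b (Loop c p) s Q.
Proof.
move=> sc NZ I0 step last.
apply: (@wp_while (fun i s => I i s /\ ram_reg s c = N - i) N) => //.
- by rewrite subn0.
- move=> i s1 iN [Is1 s1c]; split; first by rewrite /= s1c; lia.
  apply/wp_seq/wp_set; have -> : ram_eval b s1 (ESub (EReg c) (ELit 1)) = N - i.+1.
    by rewrite /= s1c; lia.
  exact: step.
- by move=> s1 [Is1 s1c]; rewrite /= s1c subnn; split=> //; apply: last; rewrite // s1c subnn.
Qed.

End WP.

(* Programs are called by inlining: a program only modifies the registers from
   some [k] on, and its callers keep their variables below [k]. *)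
Definition keeps (k : nat) (s s' : ram) : Prop :=
  forall r, r < k -> ram_reg s' r = ram_reg s r.

Definition pures (k : nat) (s s' : ram) : Prop :=
  [/\ keeps k s s', ram_mem s' = ram_mem s & ram_out s' = ram_out s].

Arguments upd m a v b /.
Infix ";;" := PSeq (at level 61, right associativity).

Lemma keeps_trans k s1 s2 s3 : keeps k s1 s2 -> keeps k s2 s3 -> keeps k s1 s3.
Proof. by move=> H12 H23 r rk; rewrite H23 // H12. Qed.

Lemma pures_trans k s1 s2 s3 : pures k s1 s2 -> pures k s2 s3 -> pures k s1 s3.
Proof.
move=> [H12 m12 o12] [H23 m23 o23]; split; first exact: keeps_trans H12 H23.
  by rewrite m23.
by rewrite o23.
Qed.

Lemma keeps_le k l s s' : k <= l -> keeps l s s' -> keeps k s s'.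
Proof. by move=> kl H r rk; apply: H; exact: leq_trans kl. Qed.

Lemma pures_le k l s s' : k <= l -> pures l s s' -> pures k s s'.
Proof. by move=> kl [H m o]; split=> //; exact: keeps_le H. Qed.

Lemma pures_setr k s s' r v : k <= r -> pures k s s' -> pures k s (setr s' r v).
Proof.
move=> kr [H m o]; split=> // i ik; rewrite /= ifN ?H //.
by rewrite neq_ltn (leq_trans ik kr).
Qed.

Lemma pures_refl k s : pures k s s. Proof. by []. Qed.

Ltac regs := repeat match goal with
  | H : keeps ?k ?s ?s' |- context [ram_reg ?s' ?r] => rewrite (H r isT)
  | H : pures ?k ?s ?s' |- context [ram_reg ?s' ?r] =>
      let K := fresh in have [K _ _] := H; rewrite (K r isT); clear K
  end.

(** * Words *)

(** The digits need not be bits, because reading past the end of a message yields 2: a message that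
    is too short still denotes a definite number. *)
Fixpoint wval (W : nat) (f : nat -> nat) : nat :=
  if W is W'.+1 then f 0 + (wval W' (fun i => f i.+1)).*2 else 0.

Definition word (W : nat) (b : seq (seq bool)) (e i : nat) : nat :=
  wval W (fun c => board_read b e (i * W + c)).

Lemma eq_wval W f g : f =1 g -> wval W f = wval W g.
Proof.
by elim: W f g => //= W IH f g fg; rewrite fg (IH _ (fun i => g i.+1)).
Qed.

(* Reads word [r35] of entry [r34] of the board into [r36], where [r5] holds the
   size of the words; here and below, [ri] is register [i]. *)
Definition WORD : prog :=
  PSet 37 (ELit 0) ;; PSet 38 (EReg 5) ;;
  Loop 38 (PSet 37 (EAdd (EReg 37) (EReg 35))) ;;
  PSet 36 (ELit 0) ;; PSet 38 (EReg 5) ;;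
  Loop 38 (PSet 36 (EAdd (EAdd (EReg 36) (EReg 36))
                      (ERead (EReg 34) (EAdd (EReg 37) (EReg 38))))).

Lemma wp_WORD Z b s W Q : ram_reg s 5 = W -> W <= Z ->
  (forall s', pures 34 s s' ->
     ram_reg s' 36 = word W b (ram_reg s 34) (ram_reg s 35) -> Q s') ->
  wp Z b WORD s Q.
Proof.
move=> sW WZ HQ.
do 2 apply/wp_seq/wp_set; apply: wp_seq.
(* The offset of the word by repeated addition; [W] is O(log n), which even the miner can afford. *)
apply: (@wp_loop _ _ (fun i s1 => [/\ pures 36 s s1 &
  ram_reg s1 37 = ram_reg s 35 * i]) W) => //.
- by rewrite /= muln0; split=> //; do 2 apply: pures_setr => //.
- move=> i s1 iW [P1 e1] c1; apply: wp_set; split=> //=; split.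
    by do 2 apply: pures_setr => //.
  by rewrite e1; regs; rewrite mulnS addnC.
move=> s1 [P1 e1] _; do 2 apply/wp_seq/wp_set.
(* Horner's scheme from the most significant bit down, with the counter as the position to read. *)
apply: (@wp_loop _ _ (fun i s2 => [/\ pures 36 s s2,
   ram_reg s2 37 = ram_reg s 35 * W &
   ram_reg s2 36 = wval i (fun c => board_read b (ram_reg s 34)
     (ram_reg s 35 * W + (W - i) + c))]) W) => //.
- by rewrite /=; regs.
- by split=> //=; do 2 apply: pures_setr => //.
- move=> i s2 iW [P2 e2 e2'] c2; apply: wp_set; split=> //=; split=> //.
    by do 2 apply: pures_setr => //.
  rewrite e2 e2'; regs; rewrite addn0 addnn addnC; congr (_ + _.*2).
  by apply: eq_wval => c; congr board_read; lia.
move=> s2 [P2 _ e2] _; apply: HQ; first exact: pures_le P2.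
by rewrite e2 subnn; apply: eq_wval => c; rewrite addn0.
Qed.

Fixpoint wbits (W v : nat) : seq bool :=
  if W is W'.+1 then odd v :: wbits W' v./2 else [::].

Lemma size_wbits W v : size (wbits W v) = W.
Proof. by elim: W v => //= W IH v; rewrite IH. Qed.

Lemma wval_wbits W v : v < 2 ^ W -> wval W (nth 2 (map nat_of_bool (wbits W v))) = v.
Proof.
elim: W v => [|W IH] v /=; first by rewrite expn0; case: v.
by rewrite expnS => vW; rewrite IH ?odd_double_half //; lia.
Qed.

Definition words (W : nat) (ws : seq nat) : seq bool :=
  flatten [seq wbits W w | w <- ws].

Lemma size_words W ws : size (words W ws) = size ws * W.
Proof. by elim: ws => //= w ws IH; rewrite size_cat size_wbits IH. Qed.

Lemma board_readE b e i :
  board_read b e i = nth 2 (map nat_of_bool (nth [::] b e)) i.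
Proof.
rewrite /board_read; elim: (nth [::] b e) i => [|c s IH] [|i] //=; exact: IH.
Qed.

Lemma eq_in_wval W f g : (forall c, c < W -> f c = g c) -> wval W f = wval W g.
Proof.
elim: W f g => //= W IH f g fg; rewrite fg // (IH _ (fun i => g i.+1)) //.
by move=> c cW; exact: fg.
Qed.

(** Only a number below [2 ^ W] survives being written and read back, whence the later bounds by
    [2 ^ W]. *)
Lemma word_words W b e ws i : nth [::] b e = words W ws -> i < size ws ->
  nth 0 ws i < 2 ^ W -> word W b e i = nth 0 ws i.
Proof.
move=> be ib iW; rewrite -[RHS](wval_wbits iW).
apply: eq_in_wval => c cW; rewrite board_readE be {be iW}.
elim: ws i ib => //= w ws IH [|i] ib;
  rewrite map_cat nth_cat size_map size_wbits.
  by rewrite mul0n cW.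
rewrite ifN; last by rewrite -leqNgt mulSn -addnA leq_addr.
by rewrite mulSn -addnA addKn IH.
Qed.

Lemma setr_id s r : setr s r (ram_reg s r) = s.
Proof.
case: s => g m o; congr MkRam; apply: funext => i /=.
by case: eqP => [->|].
Qed.

Lemma setrC s r r' v v' : r != r' ->
  setr (setr s r v) r' v' = setr (setr s r' v') r v.
Proof.
move=> rr; congr MkRam; apply: funext => i /=.
by case: (eqVneq i r') => // ->; rewrite eq_sym (negbTE rr).
Qed.

Lemma setrr s r v v' : setr (setr s r v) r v' = setr s r v'.
Proof. by congr MkRam; apply: funext => i /=; case: eqP. Qed.

Section Fragments.
Variables (Z : nat) (b : seq (seq bool)).

(* Emits [r34] as a word of [r5] bits. *)
Definition EMITW : prog :=
  PSet 35 (EReg 5) ;;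
  Loop 35 (PEmit (ESub (EReg 34) (EAdd (EHalf (EReg 34)) (EHalf (EReg 34)))) ;;
           PSet 34 (EHalf (EReg 34))).

Lemma wbits_rcons W v : wbits W.+1 v = rcons (wbits W v) (odd (iter W half v)).
Proof.
elim: W v => // W IH v; rewrite [LHS]/= -[_ :: wbits W _]/(wbits W.+1 _) IH.
by rewrite /= -iterS iterSr.
Qed.

Lemma wp_EMITW s W Q : ram_reg s 5 = W -> W <= Z ->
  (forall s', keeps 34 s s' -> ram_mem s' = ram_mem s ->
     ram_out s' = ram_out s ++ wbits W (ram_reg s 34) -> Q s') ->
  wp Z b EMITW s Q.
Proof.
move=> sW WZ HQ; apply/wp_seq/wp_set.
apply: (@wp_loop _ _ (fun i s1 => [/\ keeps 34 s s1, ram_mem s1 = ram_mem s,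
  ram_reg s1 34 = iter i half (ram_reg s 34) &
  ram_out s1 = ram_out s ++ wbits i (ram_reg s 34)]) W) => //.
- split=> //=; last by rewrite cats0.
  by have [] := @pures_setr 34 s s 35 (ram_reg s 5) isT (pures_refl _ _).
- move=> i s1 iW [k1 m1 e1 o1] c1; apply/wp_seq/wp_emit/wp_set; split=> //=.
  split=> //; last first.
    rewrite o1 e1 rcons_cat -[odd _ :: _]/(wbits i.+1 _) wbits_rcons.
    congr (_ ++ rcons _ _).
    rewrite addnn -[in X in X - _](odd_double_half (iter i half _)) addnK.
    by case: odd.
  + by rewrite e1.
  + by move=> r rk; rewrite /= !ifN ?k1 //; lia.
by move=> s1 [k1 m1 _ o1] _; exact: HQ.
Qed.

(** Multiplication by [2 ^ N] takes [N] additions, so that [m * B] costs O(log B). *)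
Lemma wp_double r c s N Q : r != c -> ram_reg s c = N -> N <= Z ->
  Q (setr (setr s r (ram_reg s r * 2 ^ N)) c 0) ->
  wp Z b (Loop c (PSet r (EAdd (EReg r) (EReg r)))) s Q.
Proof.
move=> rc sc NZ HQ.
apply: (@wp_loop _ _ (fun i s1 =>
  s1 = setr (setr s r (ram_reg s r * 2 ^ i)) c (N - i)) N) => //.
- by rewrite expn0 muln1 setr_id subn0 -sc setr_id.
- move=> i s1 iN -> _; apply: wp_set; split.
    rewrite setrr setrC 1?eq_sym // setrr; congr setr; congr setr.
    by rewrite /= (negbTE rc) eqxx addnn -muln2 -mulnA -expnSr.
  by rewrite /= (eq_sym c) (negbTE rc) !eqxx.
- by move=> _ -> _; rewrite subnn.
Qed.

Lemma wp_double_half r r' c s N Q : uniq [:: r; r'; c] ->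
  ram_reg s c = N -> N <= Z ->
  Q (setr (setr (setr s r (ram_reg s r * 2 ^ N)) r' (ram_reg s r' %/ 2 ^ N)) c 0) ->
  wp Z b (Loop c (PSet r (EAdd (EReg r) (EReg r)) ;;
                  PSet r' (EHalf (EReg r')))) s Q.
Proof.
rewrite /= !inE negb_or andbT => /andP[/andP[rr' rc] r'c] sc NZ HQ.
apply: (@wp_loop _ _ (fun i s1 => s1 = setr (setr (setr s r
  (ram_reg s r * 2 ^ i)) r' (ram_reg s r' %/ 2 ^ i)) c (N - i)) N) => //.
- by rewrite expn0 muln1 divn1 !setr_id subn0 -sc setr_id.
- move=> i s1 iN -> _; apply/wp_seq/wp_set/wp_set; split.
    congr MkRam; apply: funext => a /=; rewrite eqxx (negbTE rr') (negbTE rc).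
    rewrite (eq_sym r') (negbTE rr') (negbTE r'c) eqxx.
    case: (eqVneq a c) => [->|_].
      by rewrite !(eq_sym c) (negbTE rc) (negbTE r'c).
    case: (eqVneq a r') => [_|_]; first by rewrite -divn2 -divnMA expnSr.
    by case: eqP => // _; rewrite addnn -muln2 -mulnA expnSr.
  by rewrite /= !(eq_sym c) (negbTE rc) (negbTE r'c) eqxx.
- by move=> _ -> _; rewrite subnn.
Qed.

Definition ENe (e1 e2 : expr) : expr := EAdd (ESub e1 e2) (ESub e2 e1).

Lemma eval_ENe s e1 e2 :
  (ram_eval b s (ENe e1 e2) == 0) = (ram_eval b s e1 == ram_eval b s e2).
Proof. by rewrite /= addn_eq0 !subn_eq0 eqn_leq. Qed.

(* Entry 0 of the board stands for the initial configuration, all of whose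
   cells are 0; in the last configuration of the first claim of the prover,
   the captured symbol is that of the proposed solution. *)
Definition claim (D B W j e m a : nat) : nat :=
  if e == 0 then 0
  else if [&& e == 4, m == D & a == 4] then 2 - board_read b 1 j
  else word W b e (m * B + a).

(* [r33 := claim D B W j r30 r31 r32], where [D], [W], [j] and the binary
   logarithm of [B] are in [r3], [r5], [r6] and [r7]. *)
Definition CLAIM : prog :=
  PIf (EReg 30)
    (PIf (EAdd (ENe (EReg 30) (ELit 4))
            (EAdd (ENe (EReg 31) (EReg 3)) (ENe (EReg 32) (ELit 4))))
       (PSet 34 (EReg 30) ;; PSet 35 (EReg 31) ;; PSet 36 (EReg 7) ;;
        Loop 36 (PSet 35 (EAdd (EReg 35) (EReg 35))) ;;
        PSet 35 (EAdd (EReg 35) (EReg 32)) ;; WORD ;; PSet 33 (EReg 36))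
       (PSet 33 (ESub (ELit 2) (ERead (ELit 1) (EReg 6)))))
    (PSet 33 (ELit 0)).

Lemma wp_CLAIM s B W Q : ram_reg s 5 = W -> W <= Z ->
  B = 2 ^ ram_reg s 7 -> ram_reg s 7 <= Z ->
  (forall s', pures 30 s s' -> ram_reg s' 33 = claim (ram_reg s 3) B W
     (ram_reg s 6) (ram_reg s 30) (ram_reg s 31) (ram_reg s 32) -> Q s') ->
  wp Z b CLAIM s Q.
Proof.
move=> sW WZ sB BZ HQ; apply: wp_if => /= [/eqP/negbTE e0|e0]; last first.
  by apply/wp_set/HQ; [apply: pures_setr|rewrite /= /claim e0].
apply: wp_if => [ne|/eqP].
  do 3 apply/wp_seq/wp_set.
  apply/wp_seq/wp_double => //; apply/wp_seq/wp_set/wp_seq.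
  apply: (@wp_WORD _ _ _ W) => // s1 P1 e1.
  apply/wp_set/HQ.
    apply: pures_setr => //; apply: pures_trans (pures_le _ P1) => //.
    by do 6 apply: pures_setr => //.
  rewrite [LHS]/= e1 /= /claim e0 ifN -?sB //.
  apply/negP => /and3P[/eqP e /eqP e' /eqP e'']; apply: ne.
  by rewrite /= e e' e'' !subnn.
rewrite /= !addn_eq0 !subn_eq0 => /andP[/andP[h1 h2] /andP[/andP[h3 h4] /andP[h5 h6]]].
apply/wp_set/HQ; first by apply: pures_setr.
by rewrite /= /claim e0 !eqn_leq h1 h2 h3 h4 h5 h6.
Qed.

End Fragments.

(** * Simulation of a machine *)

Section Coding.
Variables (T : finType) (x0 : T).

(** [x0] is moved to the front to get code 0. With the start state and the blank in this role, the
    initial configuration is constantly 0, like a memory never written. *)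
Definition listing : seq T := x0 :: rem x0 (enum T).

Definition code (x : T) : nat := index x listing.

Lemma mem_listing x : x \in listing.
Proof. by rewrite -(perm_mem (perm_to_rem (mem_enum T x0))) mem_enum. Qed.

Lemma code0 : code x0 = 0.
Proof. by rewrite /code /= eqxx. Qed.

Lemma code_lt x : code x < size listing.
Proof. by rewrite index_mem mem_listing. Qed.

Lemma onth_code x : onth listing (code x) = Some x.
Proof.
by rewrite onthE (nth_map x0) ?code_lt // nth_index ?mem_listing.
Qed.

End Coding.

Section Step.
Variable M : TM.

Definition states := listing (tm_start M).
Definition symbols := listing (tm_blank M).

Definition move_code (d : direction) : nat :=
  match d with MoveLeft => 0 | Stay => 1 | MoveRight => 2 end.

Lemma moveE d i : move d i = (i + move_code d).-1.
Proof. by case: d => /=; lia. Qed.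

(* 0 means "no bit", which makes the initial configuration constantly 0. *)
Definition bit_code (o : option bool) : nat := if o is Some b then 2 - b else 0.

(** The codes 0, 1, 2 are the values of [board_read] on the input; 2, a position past the end, is
    the right marker. *)
Definition input_decode (i : nat) : option input_symbol :=
  match i with
  | 0 => Some (InputBit false) | 1 => Some (InputBit true)
  | 2 => Some RightEnd | 3 => Some LeftEnd | _ => None
  end.

(* Meaningless codes and halting states are mapped to a transition without
   effect, so that halting configurations are fixed. *)
Definition trans (u i w : nat) : nat * nat * nat * nat * nat :=
  if (onth states u, input_decode i, onth symbols w) is (Some q, Some a, Some c)
  then if tm_delta q a c is Some (q', di, c', dw, o)
    then (code (tm_start M) q', move_code di, code (tm_blank M) c',
          move_code dw, bit_code o)
    else (u, 1, w, 1, 0)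
  else (u, 1, w, 1, 0).

Definition input_at (b : seq (seq bool)) (i : nat) : nat :=
  if i == 0 then 3 else board_read b 0 i.-1.

(* A configuration is coded by the function which maps 0, 1, 2 to the state and
   the positions of the heads, 3 to the number of bits in the output, 4 to the
   captured bit, which is the [j]-th one of the output, and [5 + i] to the
   [i]-th symbol of the work tape. *)
Definition stepf (b : seq (seq bool)) (n j : nat) (c : nat -> nat) : nat -> nat :=
  let: (u, di, w, dw, o) := trans (c 0) (input_at b (c 1)) (c (5 + c 2)) in
  fun a =>
    if a == 5 + c 2 then w
    else match a with
      | 0 => u
      | 1 => minn (c 1 + di).-1 n.+1
      | 2 => (c 2 + dw).-1
      | 3 => c 3 + (o != 0)
      | 4 => if (o != 0) && (c 3 == j) then o else c 4
      | _ => c a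
      end.

Definition SETV (t : nat * nat * nat * nat * nat) : prog :=
  let: (u, di, w, dw, o) := t in
  PSet 48 (ELit u) ;; PSet 49 (ELit di) ;; PSet 50 (ELit w) ;;
  PSet 51 (ELit dw) ;; PSet 52 (ELit o).

(** The finite transition function becomes a chain of comparisons, whose length for [keys] depends
    on [M] only; the last alternative is the transition without effect. *)
Definition TABLE (ks : seq (nat * nat * nat)) : prog :=
  foldr (fun k p =>
      PIf (EAdd (EAdd (ENe (EReg 40) (ELit k.1.1)) (ENe (EReg 47) (ELit k.1.2)))
             (ENe (EReg 45) (ELit k.2))) p (SETV (trans k.1.1 k.1.2 k.2)))
    (PSet 48 (EReg 40) ;; PSet 49 (ELit 1) ;; PSet 50 (EReg 45) ;;
     PSet 51 (ELit 1) ;; PSet 52 (ELit 0)) ks.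

Definition keys : seq (nat * nat * nat) :=
  [seq (ui, w) | ui <- [seq (u, i) | u <- iota 0 (size states), i <- iota 0 4],
                 w <- iota 0 (size symbols)].

Lemma trans_default u i w : (u, i, w) \notin keys -> trans u i w = (u, 1, w, 1, 0).
Proof.
move=> nk; rewrite /trans.
case Eu: (onth states u) => [q|] //; case Ei: (input_decode i) => [a|] //.
case Ew: (onth symbols w) => [c|] //; case/negP: nk.
apply: allpairs_f; first apply: allpairs_f; rewrite mem_iota //.
- by rewrite add0n -onthTE Eu.
- by case: i Ei => [|[|[|[|i]]]].
- by rewrite add0n -onthTE Ew.
Qed.

(* Advances the configuration whose values at 0, ..., 4 and under the work head
   are in [r40], ..., [r45]. *)
Definition STEP : prog :=
  PIf (EReg 41) (PSet 47 (ERead (ELit 0) (ESub (EReg 41) (ELit 1))))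
    (PSet 47 (ELit 3)) ;;
  TABLE keys ;;
  PSet 40 (EReg 48) ;;
  PSet 41 (ESub (EAdd (EReg 41) (EReg 49)) (ELit 1)) ;;
  PSet 41 (ESub (EReg 41) (ESub (EReg 41) (EAdd (EReg 0) (ELit 1)))) ;;
  PSet 42 (ESub (EAdd (EReg 42) (EReg 51)) (ELit 1)) ;;
  PIf (EReg 52)
    (PIf (ENe (EReg 43) (EReg 6)) PSkip (PSet 44 (EReg 52)) ;;
     PSet 43 (EAdd (EReg 43) (ELit 1)))
    PSkip ;;
  PSet 45 (EReg 50).

(* Advances the configuration stored in the memory. *)
Definition SIM : prog :=
  PSet 39 (EAdd (ELit 5) (ELoad (ELit 2))) ;;
  PSet 40 (ELoad (ELit 0)) ;; PSet 41 (ELoad (ELit 1)) ;;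
  PSet 42 (ELoad (ELit 2)) ;; PSet 43 (ELoad (ELit 3)) ;;
  PSet 44 (ELoad (ELit 4)) ;; PSet 45 (ELoad (EReg 39)) ;;
  STEP ;;
  PStore (EReg 39) (EReg 45) ;;
  PStore (ELit 0) (EReg 40) ;; PStore (ELit 1) (EReg 41) ;;
  PStore (ELit 2) (EReg 42) ;; PStore (ELit 3) (EReg 43) ;;
  PStore (ELit 4) (EReg 44).

Variables (Z : nat) (b : seq (seq bool)).

Definition loaded (c : nat -> nat) (s : ram) : Prop :=
  [/\ ram_reg s 40 = c 0, ram_reg s 41 = c 1 & ram_reg s 42 = c 2] /\
  [/\ ram_reg s 43 = c 3, ram_reg s 44 = c 4 & ram_reg s 45 = c (5 + c 2)].

Lemma wp_TABLE s Q :
  (forall s', pures 48 s s' ->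
     (ram_reg s' 48, ram_reg s' 49, ram_reg s' 50, ram_reg s' 51, ram_reg s' 52)
       = trans (ram_reg s 40) (ram_reg s 47) (ram_reg s 45) -> Q s') ->
  wp Z b (TABLE keys) s Q.
Proof.
move=> HQ.
suff H ks : wp Z b (TABLE ks) s (fun s' => pures 48 s s' /\
    (ram_reg s' 48, ram_reg s' 49, ram_reg s' 50, ram_reg s' 51, ram_reg s' 52)
    = if (ram_reg s 40, ram_reg s 47, ram_reg s 45) \in ks
      then trans (ram_reg s 40) (ram_reg s 47) (ram_reg s 45)
      else (ram_reg s 40, 1, ram_reg s 45, 1, 0)).
  apply: wp_mono (H keys) _ => s' [P1 e]; apply: HQ => //; rewrite e.
  by case: ifPn => // /trans_default ->.
elim: ks => [|[[u i] w] ks IH].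
  do 4 apply/wp_seq/wp_set; apply/wp_set; split=> //.
  by do 5 apply: pures_setr => //.
rewrite [TABLE _]/=; apply: wp_if => [ne|].
  apply: wp_mono IH _ => s' [P1 ->]; split=> //; rewrite inE.
  by case: eqP => // -[e1 e2 e3]; case: ne; rewrite /= e1 e2 e3 !subnn.
rewrite /= => /eqP; rewrite !addn_eq0 !subn_eq0.
move=> /andP[/andP[/andP[h1 h2] /andP[h3 h4]] /andP[h5 h6]].
have -> : ram_reg s 40 = u by apply/eqP; rewrite eqn_leq h1.
have -> : ram_reg s 47 = i by apply/eqP; rewrite eqn_leq h3.
have -> : ram_reg s 45 = w by apply/eqP; rewrite eqn_leq h5.
rewrite inE eqxx /=; case: (trans u i w) => [[[[u' di] w'] dw] o].
do 4 apply/wp_seq/wp_set; apply/wp_set; split=> //.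
by do 5 apply: pures_setr => //.
Qed.

Lemma wp_STEP c s Q : loaded c s ->
  (forall s', pures 40 s s' ->
     [/\ [/\ ram_reg s' 40 = stepf b (ram_reg s 0) (ram_reg s 6) c 0,
             ram_reg s' 41 = stepf b (ram_reg s 0) (ram_reg s 6) c 1 &
             ram_reg s' 42 = stepf b (ram_reg s 0) (ram_reg s 6) c 2],
         ram_reg s' 43 = stepf b (ram_reg s 0) (ram_reg s 6) c 3,
         ram_reg s' 44 = stepf b (ram_reg s 0) (ram_reg s 6) c 4 &
         ram_reg s' 45 = stepf b (ram_reg s 0) (ram_reg s 6) c (5 + c 2)] ->
     Q s') ->
  wp Z b STEP s Q.
Proof.
move=> [[e0 e1 e2] [e3 e4 e5]] HQ; apply: wp_seq.
pose s1 := setr s 47 (input_at b (c 1)).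
(* Both branches of the first conditional lead to the state [s1], so the rest of the program is
   verified only once. *)
suff H : wp Z b (TABLE keys ;; PSet 40 (EReg 48) ;;
    PSet 41 (ESub (EAdd (EReg 41) (EReg 49)) (ELit 1)) ;;
    PSet 41 (ESub (EReg 41) (ESub (EReg 41) (EAdd (EReg 0) (ELit 1)))) ;;
    PSet 42 (ESub (EAdd (EReg 42) (EReg 51)) (ELit 1)) ;;
    PIf (EReg 52)
      (PIf (ENe (EReg 43) (EReg 6)) PSkip (PSet 44 (EReg 52)) ;;
       PSet 43 (EAdd (EReg 43) (ELit 1)))
      PSkip ;;
    PSet 45 (EReg 50)) s1 Q.
  apply: wp_if => /= c1; apply: wp_set; move: H; rewrite /s1 /input_at -e1.
    by rewrite (introF eqP c1) /= subn1.
  by rewrite c1.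
apply/wp_seq/wp_TABLE => s2 P2.
have -> : ram_reg s1 47 = input_at b (c 1) by [].
have -> : ram_reg s1 40 = c 0 by [].
have -> : ram_reg s1 45 = c (5 + c 2) by [].
case E: (trans _ _ _) => [[[[u di] w] dw] o] [f0 f1 f2 f3 f4].
have f40 : ram_reg s2 40 = c 0 by regs.
have f41 : ram_reg s2 41 = c 1 by regs.
have f42 : ram_reg s2 42 = c 2 by regs.
have f43 : ram_reg s2 43 = c 3 by regs.
have f44 : ram_reg s2 44 = c 4 by regs.
have g0 : ram_reg s2 0 = ram_reg s 0 by regs.
have g6 : ram_reg s2 6 = ram_reg s 6 by regs.
have P : pures 40 s s2.
  by apply: pures_trans (pures_le _ P2) => //; apply: pures_setr.
do 4 apply/wp_seq/wp_set; apply: wp_seq.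
set s3 := setr _ 42 _.
have P3 : pures 40 s s3 by do 4 apply: pures_setr => //.
have h0 : ram_reg s3 40 = u by [].
have h1 : ram_reg s3 41 = minn (c 1 + di).-1 (ram_reg s 0).+1.
  by rewrite /= f41 f1 g0; lia.
have h2 : ram_reg s3 42 = (c 2 + dw).-1 by rewrite /= f42 f3 subn1.
have h3 : ram_reg s3 43 = c 3 by [].
have h4 : ram_reg s3 44 = c 4 by [].
have h5 : ram_reg s3 50 = w by [].
have h6 : ram_reg s3 52 = o by [].
have h7 : ram_reg s3 6 = ram_reg s 6 by [].
move: s3 P3 h0 h1 h2 h3 h4 h5 h6 h7 => s3 P3 h0 h1 h2 h3 h4 h5 h6 h7.
have HQ' s4 : pures 40 s s4 -> ram_reg s4 40 = u ->
    ram_reg s4 41 = minn (c 1 + di).-1 (ram_reg s 0).+1 ->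
    ram_reg s4 42 = (c 2 + dw).-1 -> ram_reg s4 43 = c 3 + (o != 0) ->
    ram_reg s4 44 = (if (o != 0) && (c 3 == ram_reg s 6) then o else c 4) ->
    ram_reg s4 50 = w -> wp Z b (PSet 45 (EReg 50)) s4 Q.
  move=> P4 i0 i1 i2 i3 i4 i5; apply/wp_set/HQ; first exact: pures_setr.
  by rewrite /stepf E /= eqxx i0 i1 i2 i3 i4.
apply: wp_if; rewrite /= h6 => o0; last first.
  by apply/wp_skip/HQ' => //; rewrite o0 //= h3 addn0.
rewrite (introF eqP o0) /= in HQ'; apply: wp_seq.
apply: wp_if => /eqP; rewrite eval_ENe /= h3 h7 => ne.
  apply/wp_skip/wp_set/HQ' => //=; first exact: pures_setr.
    by rewrite h3.
  by rewrite (negbTE ne).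
apply/wp_set/wp_set/HQ' => //=; first by do 2 apply: pures_setr => //.
  by rewrite h3.
by rewrite ne.
Qed.

Lemma wp_SIM s Q :
  (forall s', keeps 39 s s' -> ram_out s' = ram_out s ->
     ram_mem s' = stepf b (ram_reg s 0) (ram_reg s 6) (ram_mem s) -> Q s') ->
  wp Z b SIM s Q.
Proof.
move=> HQ; do 7 apply/wp_seq/wp_set; apply/wp_seq.
set s1 := setr _ 45 _.
have P1 : pures 39 s s1 by do 7 apply: pures_setr => //.
have e39 : ram_reg s1 39 = 5 + ram_mem s 2 by [].
apply: (wp_STEP (c := ram_mem s)) => // s2 P2 [[e0 e1 e2] e3 e4 e5].
do 5 apply/wp_seq/wp_store; apply/wp_store/HQ => /=.
- case: P1 P2 => [K1 _ _] [K2 _ _]; exact: keeps_trans K1 (keeps_le _ K2).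
- by case: P1 P2 => [_ _ o1] [_ _ ->].
have -> : ram_reg s2 39 = 5 + ram_mem s 2 by regs.
have -> : ram_mem s2 = ram_mem s by case: P2.
have m1 : ram_mem s1 = ram_mem s by [].
rewrite e0 e1 e2 e3 e4 e5; apply: funext => a.
case: a => [|[|[|[|[|a]]]]] //=; case: eqP => [->|] //.
by rewrite /stepf; case: trans => [[[[? ?] ?] ?] ?] /= /eqP/negbTE ->.
Qed.

End Step.

Lemma pures_keeps k s s' : pures k s s' -> keeps k s s'.
Proof. by case. Qed.

Lemma iter_half i m : iter i half m = m %/ 2 ^ i.
Proof.
elim: i => [|i IH]; first by rewrite expn0 divn1.
by rewrite iterS IH -divn2 -divnMA expnSr.
Qed.

(** Truncated subtraction is available but no minimum; all clamping in the programs has this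
    form. *)
Lemma min_sub m n : m - (m - n) = minn m n.
Proof. by lia. Qed.

(** Multiplication by a constant is unrolled into the expression and needs no loop. *)
Definition emul (c : nat) (e : expr) : expr := iter c (EAdd e) (ELit 0).

Lemma eval_emul b s c e : ram_eval b s (emul c e) = c * ram_eval b s e.
Proof. by elim: c => //= c ->. Qed.

Lemma eval_iter_half b s i e :
  ram_eval b s (iter i EHalf e) = ram_eval b s e %/ 2 ^ i.
Proof. by rewrite -iter_half; elim: i => //= i ->. Qed.

(** * Rounds *)

Section Pointers.
Variables (p R L v : nat) (b : seq (seq bool)).

(* Messages are sequences of words of [L * v] bits, representing claims of
   [2 ^ v + 1] configurations with [2 ^ (p * v)] cells each. *)
Local Notation D := (2 ^ v).
Local Notation W := (L * v).

(* The choice of the challenger in round [i]; round 0 is that of [j]. *)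
Definition digit (i : nat) : nat := minn (word W b (3 + 2 * i) 0) D.-1.

(* After round [i], the interval in dispute goes from time [pos i * period i] to
   [(pos i).+1 * period i]. *)
Fixpoint pos (i : nat) : nat :=
  if i is i'.+1 then pos i' * D + digit i else 0.

Definition period (i : nat) : nat := 2 ^ (R * v) %/ D ^ i.

(* Where the configurations at the two ends of this interval are claimed: the
   entry of the board, and the index of the configuration in this entry. *)
Fixpoint lo (i : nat) : nat * nat :=
  if i is i'.+1 then
    if digit i == 0 then lo i' else (2 + 2 * i, digit i)
  else (0, 0).

Fixpoint hi (i : nat) : nat * nat :=
  if i is i'.+1 then
    if (digit i).+1 == D then hi i' else (2 + 2 * i, (digit i).+1)
  else (4, D).

Lemma periodS i : period i.+1 = period i %/ D.
Proof. by rewrite /period expnSr divnMA. Qed.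

(** The clamping in [digit] makes every message of the challenger a valid choice. *)
Lemma digit_lt i : digit i < D.
Proof. by rewrite /digit; have := expn_gt0 2 v; lia. Qed.

End Pointers.

Section Preamble.
Variables (K p q R L : nat).

Definition DBL (r c : nat) : prog := Loop c (PSet r (EAdd (EReg r) (EReg r))).

Definition NEXT : prog :=
  PSet 17 (EReg 2) ;;
  Loop 17 (PSet 9 (EAdd (EReg 9) (EReg 9)) ;; PSet 10 (EHalf (EReg 10))).

Definition SIZES : prog :=
  PSet 2 (ELit K) ;; PSet 8 (EReg 0) ;;
  PWhile (EReg 8)
    (PSet 8 (iter q EHalf (EReg 8)) ;; PSet 2 (EAdd (EReg 2) (ELit 1))) ;;
  PSet 7 (emul p (EReg 2)) ;; PSet 5 (emul L (EReg 2)) ;;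
  PSet 3 (ELit 1) ;; PSet 8 (EReg 2) ;; DBL 3 8 ;;
  PSet 4 (ELit 1) ;; PSet 8 (EReg 7) ;; DBL 4 8 ;;
  PSet 10 (ELit 1) ;; PSet 8 (emul R (EReg 2)) ;; DBL 10 8.

(** Among [c] messages are the choices of rounds 0, ..., [c./2.-1]. That of round 0 is [j], which
    leaves [c./2.-1] digits to process. *)
Definition POINTERS : prog :=
  PSet 34 (ELit 3) ;; PSet 35 (ELit 0) ;; WORD ;; PSet 6 (EReg 36) ;;
  PSet 9 (ELit 0) ;; PSet 11 (ELit 0) ;; PSet 12 (ELit 0) ;;
  PSet 13 (ELit 4) ;; PSet 14 (EReg 3) ;; PSet 8 (ELit 1) ;;
  PSet 15 (ESub (EHalf (EReg 1)) (ELit 1)) ;;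
  Loop 15
    (PSet 34 (EAdd (ELit 3) (EAdd (EReg 8) (EReg 8))) ;; PSet 35 (ELit 0) ;;
     WORD ;;
     PSet 16 (ESub (EReg 36) (ESub (EReg 36) (ESub (EReg 3) (ELit 1)))) ;;
     NEXT ;; PSet 9 (EAdd (EReg 9) (EReg 16)) ;;
     PIf (EReg 16)
       (PSet 11 (EAdd (ELit 2) (EAdd (EReg 8) (EReg 8))) ;;
        PSet 12 (EReg 16)) PSkip ;;
     PIf (ESub (EReg 3) (EAdd (EReg 16) (ELit 1)))
       (PSet 13 (EAdd (ELit 2) (EAdd (EReg 8) (EReg 8))) ;;
        PSet 14 (EAdd (EReg 16) (ELit 1))) PSkip ;;
     PSet 8 (EAdd (EReg 8) (ELit 1))).

(* [up_log (2 ^ q) n.+1] is the least [l] such that [n < 2 ^ (q * l)]. *)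
Definition scale (n : nat) : nat := K + up_log (2 ^ q) n.+1.

Variables (Z : nat) (b : seq (seq bool)).

(* The contents of the first 15 registers when the digits of the first [i]
   rounds have been processed. *)
Definition param_list (n c i v : nat) : seq nat :=
  [:: n; c; v; 2 ^ v; 2 ^ (p * v); L * v; word (L * v) b 3 0; p * v; i.+1;
      pos L v b i; period R v i; (lo L v b i).1; (lo L v b i).2;
      (hi L v b i).1; (hi L v b i).2].

Definition params (n c i : nat) (s : ram) : Prop :=
  forall r, r < 15 -> ram_reg s r = nth 0 (param_list n c i (scale n)) r.

Lemma params_keeps n c i k s s' : 14 < k -> params n c i s -> keeps k s s' ->
  params n c i s'.
Proof. by move=> k15 H K' r r15; rewrite (K' _ (leq_trans r15 k15)); exact: H. Qed.

Hypothesis q_gt0 : 0 < q.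

Lemma wp_SIZES s n c Q : ram_reg s 0 = n -> ram_reg s 1 = c ->
  L * scale n <= Z -> p * scale n <= Z -> R * scale n <= Z -> scale n <= Z ->
  (forall s', ram_mem s' = ram_mem s -> ram_out s' = ram_out s ->
     [/\ ram_reg s' 0 = n, ram_reg s' 1 = c & ram_reg s' 2 = scale n] ->
     [/\ ram_reg s' 3 = 2 ^ scale n, ram_reg s' 4 = 2 ^ (p * scale n) &
         ram_reg s' 5 = L * scale n] ->
     ram_reg s' 7 = p * scale n -> ram_reg s' 10 = 2 ^ (R * scale n) -> Q s') ->
  wp Z b SIZES s Q.
Proof.
move=> s0 s1 LZ pZ RZ vZ HQ; do 2 apply/wp_seq/wp_set; apply: wp_seq.
have Q1 : 1 < 2 ^ q by rewrite -(expn0 2) ltn_exp2l.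
apply: (@wp_while _ _ (fun i s1 => [/\ pures 2 s s1, ram_reg s1 2 = K + i &
   ram_reg s1 8 = n %/ (2 ^ q) ^ i]) (up_log (2 ^ q) n.+1)).
- by apply: leq_trans vZ; rewrite leq_addl.
- split=> /=; first by do 2 apply: pures_setr => //.
    by rewrite addn0.
  by rewrite expn0 divn1.
- move=> i s2 iN [P2 e2 e8]; split.
    rewrite /= e8 => /eqP; rewrite -leqn0 leqNgt divn_gt0 ?expn_gt0 //.
    rewrite -ltnNge => nQ.
    by have := up_log_min Q1 nQ; rewrite leqNgt iN.
  apply/wp_seq/wp_set/wp_set; split=> /=; first by do 2 apply: pures_setr => //.
    by rewrite e2 addn1 addnS.
  by rewrite eval_iter_half /= e8 -divnMA -expnSr.
move=> s2 [P2 e2 e8]; split.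
  by rewrite /= e8 divn_small //; exact: up_logP.
do 4 apply/wp_seq/wp_set; apply/wp_seq/wp_double => //; rewrite /= ?e2 //.
do 2 apply/wp_seq/wp_set; apply/wp_seq/wp_double => //;
  rewrite /= ?eval_emul /= ?e2 //.
apply/wp_seq/wp_set/wp_seq/wp_set/wp_double => //;
  rewrite /= ?eval_emul /= ?e2 //.
case: P2 => k2 m2 o2; apply: HQ => //=; rewrite ?eval_emul /= ?e2 ?mul1n //.
by split; rewrite ?(k2 0 isT) ?(k2 1 isT).
Qed.

Lemma wp_NEXT s n c i Q : params n c i s -> scale n <= Z ->
  Q (setr (setr (setr (setr s 17 (scale n)) 9 (pos L (scale n) b i * 2 ^ scale n)) 10
    (period R (scale n) i.+1)) 17 0) ->
  wp Z b NEXT s Q.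
Proof.
move=> Ps vZ HQ; have s2 : ram_reg s 2 = scale n by rewrite Ps.
apply/wp_seq/wp_set/wp_double_half => //=.
  by rewrite s2.
by rewrite s2 (Ps 9 isT) (Ps 10 isT) -periodS.
Qed.

Lemma params_intro n c i s : ram_reg s 0 = n -> ram_reg s 1 = c ->
  ram_reg s 2 = scale n -> ram_reg s 3 = 2 ^ scale n ->
  ram_reg s 4 = 2 ^ (p * scale n) -> ram_reg s 5 = L * scale n ->
  ram_reg s 6 = word (L * scale n) b 3 0 -> ram_reg s 7 = p * scale n ->
  ram_reg s 8 = i.+1 -> ram_reg s 9 = pos L (scale n) b i ->
  ram_reg s 10 = period R (scale n) i ->
  (ram_reg s 11, ram_reg s 12) = lo L (scale n) b i ->
  (ram_reg s 13, ram_reg s 14) = hi L (scale n) b i -> params n c i s.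
Proof.
move=> ? ? ? ? ? ? ? ? ? ? ? e1 e2; rewrite /params /param_list -e1 -e2 => r.
by do 15 case: r => [|r] //.
Qed.

Lemma wp_POINTERS s n c Q : ram_reg s 0 = n -> ram_reg s 1 = c ->
  ram_reg s 2 = scale n -> ram_reg s 3 = 2 ^ scale n ->
  ram_reg s 4 = 2 ^ (p * scale n) -> ram_reg s 5 = L * scale n ->
  ram_reg s 7 = p * scale n -> ram_reg s 10 = 2 ^ (R * scale n) ->
  L * scale n <= Z -> scale n <= Z -> (c./2).-1 <= Z ->
  (forall s', ram_mem s' = ram_mem s -> ram_out s' = ram_out s ->
     params n c (c./2).-1 s' -> Q s') ->
  wp Z b POINTERS s Q.
Proof.
move=> e0 e1 e2 e3 e4 e5 e7 e10 LZ vZ cZ HQ.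
do 2 apply/wp_seq/wp_set; apply/wp_seq/(@wp_WORD _ _ _ (L * scale n)) => //.
move=> s1 P1 /= e36; have [k1 m1 o1] := P1.
do 8 apply/wp_seq/wp_set.
apply: (@wp_loop _ _ (fun i s2 => [/\ ram_mem s2 = ram_mem s,
  ram_out s2 = ram_out s & params n c i s2]) (c./2).-1) => //.
- by rewrite /=; regs; rewrite /= e1 subn1.
- split=> //; apply: params_intro => /=; regs => //.
    by rewrite /period expn0 divn1.
  by rewrite /= e3.
- move=> i s2 ic [m2 o2 Ps] c2.
  set s2' := setr s2 15 _.
  have {}Ps : params n c i s2'.
    by apply: (params_keeps (k := 15)) Ps _ => //; apply: pures_keeps; apply: pures_setr.
  have {}c2 : ram_reg s2' 15 = (c./2).-1 - i.+1 by [].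
  have {}m2 : ram_mem s2' = ram_mem s by [].
  have {}o2 : ram_out s2' = ram_out s by [].
  move: s2' Ps c2 m2 o2 => {}s2 Ps c2 m2 o2.
  do 2 apply/wp_seq/wp_set; apply/wp_seq/(@wp_WORD _ _ _ (L * scale n)) => //=.
    by rewrite Ps.
  move=> s3 [k3 m3 o3]; rewrite Ps //= => f36.
  apply/wp_seq/wp_set; apply: wp_seq.
  set s4 := setr _ 16 _.
  have f16 : ram_reg s4 16 = digit L (scale n) b i.+1.
    rewrite /= f36 (k3 3 isT) /= (Ps 3 isT) /= subn1 min_sub /digit.
    by rewrite mul2n -addnn.
  have Ps4 : params n c i s4.
    apply: (params_keeps (k := 16)) Ps _ => // r r16; rewrite /s4 /= ifN; last by lia.
    by rewrite k3 /= ?ifN //; lia.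
  have m4 : ram_mem s4 = ram_mem s by rewrite /= m3.
  have o4 : ram_out s4 = ram_out s by rewrite /= o3.
  have f15 : ram_reg s4 15 = (c./2).-1 - i.+1 by rewrite /= (k3 15 isT).
  move: s4 f16 Ps4 m4 o4 f15 => s4 f16 Ps4 m4 o4 f15.
  apply: (wp_NEXT Ps4) => //; apply/wp_seq/wp_set; apply: wp_seq.
  set s5 := setr _ 9 _.
  have Pk k : k < 9 -> ram_reg s5 k = nth 0 (param_list n c i (scale n)) k.
    by move=> k9; rewrite /= !ifN ?Ps4 //; lia.
  have f9 : ram_reg s5 9 = pos L (scale n) b i.+1 by rewrite /= f16.
  have f10 : ram_reg s5 10 = period R (scale n) i.+1 by [].
  have g15 : ram_reg s5 15 = (c./2).-1 - i.+1 by [].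
  have g16 : ram_reg s5 16 = digit L (scale n) b i.+1 by [].
  have m5 : ram_mem s5 = ram_mem s by [].
  have o5 : ram_out s5 = ram_out s by [].
  have f11 : ram_reg s5 11 = (lo L (scale n) b i).1 by rewrite /= (Ps4 11 isT).
  have f12 : ram_reg s5 12 = (lo L (scale n) b i).2 by rewrite /= (Ps4 12 isT).
  have f13 : ram_reg s5 13 = (hi L (scale n) b i).1 by rewrite /= (Ps4 13 isT).
  have f14 : ram_reg s5 14 = (hi L (scale n) b i).2 by rewrite /= (Ps4 14 isT).
  move: s5 Pk f9 f10 g15 g16 m5 o5 f11 f12 f13 f14 => s5 Pk f9 f10 g15 g16 m5 o5
    f11 f12 f13 f14.
  (* The branch that keeps the pointers is also described as an assignment, of the old values, so
     that one final state covers both branches. *)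
  apply: (@wp_mono _ _ _ _ (fun s6 => s6 = setr (setr s5 11 (lo L (scale n) b i.+1).1)
    12 (lo L (scale n) b i.+1).2)).
    apply: wp_if => /= [/eqP|]; rewrite g16 => d0.
      rewrite (negbTE d0); apply/wp_seq/wp_set/wp_set => /=.
      rewrite g16 (Pk 8 isT) /=; congr (setr (setr _ _ _) _ _); lia.
    by apply: wp_skip; rewrite d0 /= -f11 -f12 -{2}(setr_id s5 11) !setr_id.
  move=> _ ->; apply: wp_seq.
  apply: (@wp_mono _ _ _ _ (fun s6 => s6 = setr (setr
    (setr (setr s5 11 (lo L (scale n) b i.+1).1) 12 (lo L (scale n) b i.+1).2)
    13 (hi L (scale n) b i.+1).1) 14 (hi L (scale n) b i.+1).2)).
    have dD := digit_lt L (scale n) b i.+1.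
    have : hi L (scale n) b i.+1 = if (digit L (scale n) b i.+1).+1 == 2 ^ scale n
      then hi L (scale n) b i else (2 + 2 * i.+1, (digit L (scale n) b i.+1).+1) by [].
    move: (lo _ _ _ i.+1) (hi _ _ _ i.+1) => l u Eu.
    apply: wp_if => /=; rewrite g16 (Pk 3 isT) /= => /eqP;
      rewrite subn_eq0 addn1 => d0.
      rewrite {}Eu ifN; last by rewrite eqn_leq dD.
      apply/wp_seq/wp_set/wp_set => /=.
      rewrite g16 (Pk 8 isT) /= addn1; congr (setr (setr _ _ _) _ _); lia.
    apply: wp_skip; rewrite {}Eu ifT; last by rewrite eqn_leq dD.
    rewrite -f13 -f14; congr MkRam; apply: funext => r /=.
    by case: (eqVneq r 14) => [->|_] //; case: (eqVneq r 13) => [->|_].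
  move=> _ ->; apply: wp_set; split=> //; split=> //.
  apply: params_intro => //=; rewrite ?(Pk 0 isT) ?(Pk 1 isT) ?(Pk 2 isT)
    ?(Pk 3 isT) ?(Pk 4 isT) ?(Pk 5 isT) ?(Pk 6 isT) ?(Pk 7 isT) ?(Pk 8 isT) //=.
  + by rewrite addn1.
  + by case: ifP => //; case: lo.
  + by case: ifP => //; case: hi.
by move=> s2 [m2 o2 Ps] _; apply: HQ => //; rewrite ?m2 ?o2.
Qed.

Definition PRE : prog := SIZES ;; POINTERS.

Lemma wp_PRE s n c Q : ram_reg s 0 = n -> ram_reg s 1 = c ->
  L * scale n <= Z -> p * scale n <= Z -> R * scale n <= Z -> scale n <= Z ->
  (c./2).-1 <= Z ->
  (forall s', ram_mem s' = ram_mem s -> ram_out s' = ram_out s ->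
     params n c (c./2).-1 s' -> Q s') ->
  wp Z b PRE s Q.
Proof.
move=> e0 e1 LZ pZ RZ vZ cZ HQ; apply: wp_seq.
apply: (wp_SIZES e0 e1) => // s1 m1 o1 [f0 f1 f2] [f3 f4 f5] f7 f10.
apply: (wp_POINTERS f0 f1) => // s2 m2 o2 Ps.
by apply: HQ => //; rewrite ?m2 ?o2.
Qed.

End Preamble.

(** * Players and miners *)

Lemma words_cat W s1 s2 : words W (s1 ++ s2) = words W s1 ++ words W s2.
Proof. by rewrite /words map_cat flatten_cat. Qed.

Lemma words_rcons W s w : words W (rcons s w) = words W s ++ wbits W w.
Proof. by rewrite -cats1 words_cat /words /= cats0. Qed.

Definition first (P : nat * nat -> bool) (l : seq (nat * nat)) : nat * nat :=
  head (0, 0) [seq x <- l | P x].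

Lemma first_rcons P l x : first P (rcons l x) =
  if ~~ has P l && P x then x else first P l.
Proof.
rewrite /first filter_rcons has_filter negbK.
by case: ifP => Px; case: [seq x <- l | P x] => //=; rewrite andbF.
Qed.

(** The pairs of an interval and a cell scanned so far, in lexicographic order: [m] full rows of [B]
    cells and [a] cells of the next. The first wrong pair thus lies in the first wrong interval. *)
Definition grid (B m a : nat) : seq (nat * nat) :=
  flatten (mkseq (fun i => mkseq (pair i) B) m) ++ mkseq (pair m) a.

Lemma gridS B m a : grid B m a.+1 = rcons (grid B m a) (m, a).
Proof. by rewrite /grid mkseqS -rcons_cat. Qed.

Lemma grid_row B m : grid B m B = grid B m.+1 0.
Proof. by rewrite /grid mkseqS flatten_rcons cats0. Qed.

Section Players.
Variables (M : TM) (K p q R L : nat).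
Hypothesis q_gt0 : 0 < q.
Variables (Z : nat) (b : seq (seq bool)) (n : nat).

Local Notation v := (scale K q n).
Local Notation D := (2 ^ v).
Local Notation B := (2 ^ (p * v)).
Local Notation W := (L * v).
Local Notation j0 := (word W b 3 0).
Local Notation params := (params K p q R L b).

Definition conf (j i : nat) : nat -> nat := iter i (stepf M b n j) (fun=> 0).

(* Configuration [m] in the entry that an honest prover writes in round [i.+1]. *)
Definition truth (i m : nat) : nat -> nat :=
  conf j0 ((pos L v b i * D + m) * period R v i.+1).

(** Players keep nothing between messages and simulate the machine from the start each time. The
    starting time of the disputed interval is a product, realised by nesting loops: [RUN] advances
    by one period, and [SKIP] repeats it. *)
Definition RUN : prog := PSet 38 (EReg 10) ;; Loop 38 (SIM M).

Definition SKIP : prog := PSet 16 (EReg 9) ;; Loop 16 RUN.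

Definition DUMP : prog :=
  PSet 32 (ELit 0) ;; PSet 33 (EReg 4) ;;
  Loop 33 (PSet 34 (ELoad (EReg 32)) ;; EMITW ;;
           PSet 32 (EAdd (EReg 32) (ELit 1))).

Lemma wp_RUN s Q : ram_reg s 10 <= Z ->
  (forall s', keeps 38 s s' -> ram_out s' = ram_out s ->
     ram_mem s' = iter (ram_reg s 10) (stepf M b (ram_reg s 0) (ram_reg s 6))
       (ram_mem s) -> Q s') ->
  wp Z b RUN s Q.
Proof.
move=> EZ HQ; apply/wp_seq/wp_set.
apply: (@wp_loop _ _ (fun i s1 => [/\ keeps 38 s s1, ram_out s1 = ram_out s &
  ram_mem s1 = iter i (stepf M b (ram_reg s 0) (ram_reg s 6)) (ram_mem s)])
  (ram_reg s 10)) => //.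
- by split=> // r rk; rewrite /= ifN //; lia.
- move=> i s1 iE [k1 o1 m1] c1; apply: wp_SIM => s2 k2 o2 m2; split; last first.
    by rewrite (k2 38 isT).
  split.
  + move=> r rk; rewrite k2 1?ltnS 1?ltnW //= ifN ?k1 //; lia.
  + by rewrite o2.
  + by rewrite m2 /= m1 (k1 0 isT) (k1 6 isT).
by move=> s1 [k1 o1 m1] _; apply: HQ.
Qed.

Lemma wp_DUMP s Q : ram_reg s 4 <= Z -> ram_reg s 5 <= Z ->
  (forall s', keeps 32 s s' -> ram_mem s' = ram_mem s ->
     ram_out s' = ram_out s ++
       words (ram_reg s 5) (mkseq (ram_mem s) (ram_reg s 4)) -> Q s') ->
  wp Z b DUMP s Q.
Proof.
move=> BZ WZ HQ; do 2 apply/wp_seq/wp_set.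
apply: (@wp_loop _ _ (fun i s1 => [/\ keeps 32 s s1, ram_mem s1 = ram_mem s,
  ram_reg s1 32 = i &
  ram_out s1 = ram_out s ++ words (ram_reg s 5) (mkseq (ram_mem s) i)])
  (ram_reg s 4)) => //.
- split=> //=; last by rewrite cats0.
  by move=> r rk; rewrite /= !ifN //; lia.
- move=> i s1 iE [k1 m1 e1 o1] c1; apply/wp_seq/wp_set; apply/wp_seq.
  apply: (@wp_EMITW _ _ _ (ram_reg s 5)) => //=; first by rewrite (k1 5 isT).
  move=> s2 k2 m2 o2; apply/wp_set; split; last by rewrite /= (k2 33 isT).
  split=> /=.
  + by move=> r rk; rewrite /= ifN ?k2 /= ?ifN ?k1 //; lia.
  + by rewrite m2.
  + by rewrite (k2 32 isT) /= e1 addn1.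
  + by rewrite o2 /= o1 mkseqS words_rcons -catA e1 m1.
by move=> s1 [k1 m1 _ o1] _; exact: HQ.
Qed.

(** The registers after [NEXT]: position and period are already in the units of round [i.+1], but
    its digit has not been added. *)
Definition advanced_list (c i : nat) : seq nat :=
  [:: n; c; v; D; B; W; j0; p * v; i.+1; pos L v b i * D; period R v i.+1;
      (lo L v b i).1; (lo L v b i).2; (hi L v b i).1; (hi L v b i).2].

Definition advanced (c i : nat) (s : ram) : Prop :=
  forall r, r < 15 -> ram_reg s r = nth 0 (advanced_list c i) r.

Lemma advanced_keeps c i k s s' : 14 < k -> advanced c i s -> keeps k s s' ->
  advanced c i s'.
Proof. by move=> k15 H K' r r15; rewrite (K' _ (leq_trans r15 k15)); exact: H. Qed.

Lemma wp_ADVANCE s c i Q : params n c i s -> v <= Z ->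
  (forall s', ram_mem s' = ram_mem s -> ram_out s' = ram_out s ->
     advanced c i s' -> Q s') ->
  wp Z b NEXT s Q.
Proof.
move=> Ps vZ HQ; apply: (wp_NEXT Ps) => //; apply: HQ => // r.
move=> r15.
by move: (Ps r r15); do 15 (case: r r15 => [|r] //= r15).
Qed.

Lemma wp_SKIP s c i Q : advanced c i s -> pos L v b i * D <= Z ->
  period R v i.+1 <= Z -> ram_mem s = (fun=> 0) ->
  (forall s', keeps 16 s s' -> ram_out s' = ram_out s ->
     ram_mem s' = truth i 0 -> Q s') ->
  wp Z b SKIP s Q.
Proof.
move=> As NZ EZ m0 HQ; apply/wp_seq/wp_set.
apply: (@wp_loop _ _ (fun k s1 => [/\ keeps 16 s s1, ram_out s1 = ram_out s &
  ram_mem s1 = conf j0 (k * period R v i.+1)]) (pos L v b i * D)) => //.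
- by rewrite /= (As 9 isT).
- split=> //=.
  by move=> r rk; rewrite /= ifN //; lia.
- move=> k s1 kE [k1 o1 m1] c1; apply: wp_RUN => [|s2 k2 o2 m2].
    by rewrite /= (k1 10 isT) (As 10 isT).
  split; last by rewrite (k2 16 isT).
  split.
  + by move=> r rk; rewrite k2 /= ?ifN ?k1 //; lia.
  + by rewrite o2.
  + rewrite m2 /= (k1 10 isT) (k1 0 isT) (k1 6 isT) (As 10 isT) (As 0 isT).
    by rewrite (As 6 isT) /= m1 mulSn /conf iterD.
by move=> s1 [k1 o1 m1] _; apply: HQ; rewrite // m1 /truth addn0.
Qed.

Definition claims (i : nat) : seq nat :=
  flatten (mkseq (fun m => mkseq (truth i m) B) D.+1).

Definition PROVER : prog :=
  PRE K p q R L ;; NEXT ;; SKIP ;; PSet 16 (EAdd (EReg 3) (ELit 1)) ;;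
  Loop 16 (DUMP ;; RUN).

Lemma wp_RUN_truth s c i m Q : advanced c i s -> period R v i.+1 <= Z ->
  ram_mem s = truth i m ->
  (forall s', keeps 38 s s' -> ram_out s' = ram_out s ->
     ram_mem s' = truth i m.+1 -> Q s') ->
  wp Z b RUN s Q.
Proof.
move=> As EZ m0 HQ; apply: wp_RUN => [|s2 k2 o2 m2]; first by rewrite (As 10 isT).
apply: HQ => //; rewrite m2 (As 10 isT) (As 0 isT) (As 6 isT) /= m0.
by rewrite /truth /conf -iterD addnS mulSn.
Qed.

Lemma wp_PROVER s c Q : ram_reg s 0 = n -> ram_reg s 1 = c ->
  ram_mem s = (fun=> 0) ->
  W <= Z -> p * v <= Z -> R * v <= Z -> v <= Z -> (c./2).-1 <= Z ->
  D < Z -> B <= Z ->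
  pos L v b (c./2).-1 * D <= Z -> period R v (c./2).-1.+1 <= Z ->
  (forall s', ram_out s' = ram_out s ++ words W (claims (c./2).-1) -> Q s') ->
  wp Z b PROVER s Q.
Proof.
move=> s0 s1 m0 WZ pZ RZ vZ cZ DZ BZ NZ EZ HQ.
apply/wp_seq/(wp_PRE q_gt0 s0 s1) => // s2 m2 o2 Ps.
apply/wp_seq/(wp_ADVANCE Ps) => // s3 m3 o3 As.
apply/wp_seq/(wp_SKIP As) => //; first by rewrite m3 m2.
move=> s4 k4 o4 m4; have {}As : advanced c (c./2).-1 s4 by apply: advanced_keeps As k4.
apply/wp_seq/wp_set.
apply: (@wp_loop _ _ (fun m s5 => [/\ advanced c (c./2).-1 s5,
  ram_mem s5 = truth (c./2).-1 m & ram_out s5 = ram_out s ++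
    words W (flatten (mkseq (fun m => mkseq (truth (c./2).-1 m) B) m))]) D.+1) => //.
- by rewrite /= (As 3 isT) addn1.
- split=> //=; last by rewrite o4 o3 o2 cats0.
  by move=> r r15; rewrite /= ifN ?As //; lia.
- move=> m s5 mD [A5 m5 o5] c5.
  set s6 := setr _ _ _; have {}A5 : advanced c (c./2).-1 s6.
    by move=> r r15; rewrite /= ifN ?A5 //; lia.
  have e4 : ram_reg s6 4 = B := A5 4 isT.
  have e5 : ram_reg s6 5 = W := A5 5 isT.
  apply/wp_seq/wp_DUMP; rewrite ?e4 ?e5 // => s7 k7 m7 o7.
  have A7 : advanced c (c./2).-1 s7 by apply: advanced_keeps A5 k7.
  apply: (wp_RUN_truth A7 EZ (m := m)) => [|s8 k8 o8 m8]; first by rewrite m7.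
  split; last by rewrite (k8 16 isT) (k7 16 isT).
  split=> //; first by apply: advanced_keeps A7 k8.
  rewrite o8 o7 (o5 : ram_out s6 = _) (m5 : ram_mem s6 = _) mkseqS.
  by rewrite flatten_rcons words_cat catA.
by move=> s5 [_ _ o5] _; exact: HQ.
Qed.

Definition claimed (lm : nat * nat) : nat -> nat := claim b D B W j0 lm.1 lm.2.

Lemma wp_claimed e m a s Q :
  [/\ ram_reg s 3 = D, ram_reg s 5 = W, ram_reg s 6 = j0 & ram_reg s 7 = p * v] ->
  W <= Z -> p * v <= Z -> e < 30 -> m < 30 ->
  (forall s1, pures 30 s s1 -> ram_eval b s1 a = ram_eval b s a) ->
  (forall s', pures 30 s s' -> ram_reg s' 33 =
     claimed (ram_reg s e, ram_reg s m) (ram_eval b s a) -> Q s') ->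
  wp Z b (PSet 30 (EReg e) ;; PSet 31 (EReg m) ;; PSet 32 a ;; CLAIM) s Q.
Proof.
move=> [e3 e5 e6 e7] WZ pZ e30 m30 ea HQ; do 3 apply/wp_seq/wp_set.
have Em : ram_reg (setr s 30 (ram_reg s e)) m = ram_reg s m by rewrite /= ifN //; lia.
rewrite [ram_eval _ _ a]ea; last by do 2 apply: pures_setr => //.
apply: (@wp_CLAIM _ _ _ B W) => /=; rewrite ?e5 ?e7 //= => s1 P1 e1.
apply: HQ; first by apply: pures_trans P1; do 3 apply: pures_setr => //.
by rewrite e1 e3 e6 /claimed /= ifN //; lia.
Qed.

(* Where the configuration at the right end of the [m]-th of the intervals of
   round [i.+1] is claimed. *)
Definition right_end (i m : nat) : nat * nat :=
  if m.+1 == D then hi L v b i else (2 + 2 * i.+1, m.+1).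

Definition wrong (i : nat) (ma : nat * nat) : bool :=
  claimed (right_end i ma.1) ma.2 != truth i ma.1.+1 ma.2.

Definition ROW : prog :=
  PSet 26 (ELit 0) ;; PSet 19 (EReg 4) ;;
  Loop 19
    ((PSet 30 (EReg 24) ;; PSet 31 (EReg 25) ;; PSet 32 (EReg 26) ;; CLAIM) ;;
     PIf (ENe (EReg 33) (ELoad (EReg 26)))
       (PIf (EReg 20) PSkip
          (PSet 20 (ELit 1) ;; PSet 21 (ESub (EReg 23) (ELit 1)) ;;
           PSet 22 (EReg 26)))
       PSkip ;;
     PSet 26 (EAdd (EReg 26) (ELit 1))).

Definition SEARCH : prog :=
  NEXT ;; SKIP ;; PSet 20 (ELit 0) ;; PSet 21 (ELit 0) ;; PSet 22 (ELit 0) ;;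
  PSet 23 (ELit 0) ;; PSet 16 (EReg 3) ;;
  Loop 16
    (RUN ;; PSet 23 (EAdd (EReg 23) (ELit 1)) ;;
     PIf (ENe (EReg 23) (EReg 3))
       (PSet 24 (EAdd (ELit 2) (EAdd (EReg 8) (EReg 8))) ;; PSet 25 (EReg 23))
       (PSet 24 (EReg 13) ;; PSet 25 (EReg 14)) ;;
     ROW).

Definition found (P : nat * nat -> bool) (l : seq (nat * nat)) (s : ram) : Prop :=
  ram_reg s 20 = has P l /\ (ram_reg s 21, ram_reg s 22) = first P l.

Lemma wp_ROW s c i m Q : advanced c i s -> W <= Z -> p * v <= Z -> B <= Z ->
  (ram_reg s 24, ram_reg s 25) = right_end i m -> ram_reg s 23 = m.+1 ->
  ram_mem s = truth i m.+1 -> found (wrong i) (grid B m 0) s ->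
  (forall s', keeps 19 s s' -> ram_mem s' = ram_mem s -> ram_out s' = ram_out s ->
     ram_reg s' 23 = m.+1 -> found (wrong i) (grid B m.+1 0) s' -> Q s') ->
  wp Z b ROW s Q.
Proof.
move=> As WZ pZ BZ e24 e23 m0 [e20 e21] HQ; do 2 apply/wp_seq/wp_set.
apply: (@wp_loop _ _ (fun a s1 => [/\ keeps 19 s s1, ram_mem s1 = ram_mem s &
    ram_out s1 = ram_out s] /\
  [/\ (ram_reg s1 24, ram_reg s1 25) = right_end i m, ram_reg s1 23 = m.+1,
   ram_reg s1 26 = a & found (wrong i) (grid B m a) s1]) B) => //.
- by rewrite /= (As 4 isT).
- split; split=> //; by move=> r rk; rewrite /= !ifN //; lia.
- move=> a s1 aB [[k1 m1 o1] [f24 f23 f26 [f20 f21]]] c1.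
  set s2 := setr s1 19 _; have A2 : advanced c i s2.
    by move=> r r15; rewrite /= ifN ?k1 ?As //; lia.
  apply/wp_seq/wp_claimed => //=.
  + by split; [exact: (A2 3 isT)|exact: (A2 5 isT)|exact: (A2 6 isT)|exact: (A2 7 isT)].
  + by move=> s3 [k3 _ _]; rewrite (k3 26 isT).
  move=> s3 P3; rewrite f26 [(ram_reg s1 24, _)]f24 => f33.
  have [k3 m3 o3] := P3; apply: wp_seq.
  have ne : (ram_reg s3 33 != ram_mem s3 (ram_reg s3 26)) = wrong i (m, a).
    by rewrite f33 m3 (k3 26 isT) /= f26 m1 m0.
  have Pf s4 : pures 20 s3 s4 -> ram_reg s4 23 = m.+1 -> ram_reg s4 26 = a ->
      (ram_reg s4 24, ram_reg s4 25) = right_end i m ->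
      found (wrong i) (grid B m a.+1) s4 ->
      wp Z b (PSet 26 (EAdd (EReg 26) (ELit 1))) s4 (fun s2 =>
        ([/\ keeps 19 s s2, ram_mem s2 = ram_mem s & ram_out s2 = ram_out s] /\
         [/\ (ram_reg s2 24, ram_reg s2 25) = right_end i m,
             ram_reg s2 23 = m.+1, ram_reg s2 26 = a.+1 &
             found (wrong i) (grid B m a.+1) s2]) /\
         ram_reg s2 19 = B - a.+1).
    move=> [k4 m4 o4] g23 g26 g24 [g20 g21]; apply: wp_set; split; last first.
      by rewrite /= (k4 19 isT) (k3 19 isT).
    split; split=> //=.
    + by move=> r rk; rewrite /= ifN ?k4 ?k3 /= ?ifN ?k1 //; lia.
    + by rewrite m4 m3.
    + by rewrite o4 o3.
    + by rewrite g26 addn1.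
  have f3 k : 19 < k < 30 -> ram_reg s3 k = ram_reg s1 k.
    by move=> /andP[k19 k30]; rewrite k3 /= ?ifN //; lia.
  apply: wp_if => /eqP; rewrite eval_ENe [X in X == _]/= [X in _ == X]/=
    -[_ == _]negbK ne => w.
    have {}w : wrong i (m, a) by move: w; rewrite negbK.
    apply: wp_if => /=; rewrite f3 // f20 => h.
      have {}h : has (wrong i) (grid B m a) by case: has h.
      apply/wp_skip/Pf; rewrite ?f3 //; split; rewrite !f3 // gridS.
        by rewrite f20 has_rcons h orbT.
      by rewrite first_rcons h.
    have {}h : has (wrong i) (grid B m a) = false by case: has h.
    apply/wp_seq/wp_set/wp_seq/wp_set/wp_set/Pf => /=; rewrite ?f3 //.
      by do 3 apply: pures_setr => //.
    split; rewrite /= ?f3 // gridS; first by rewrite has_rcons w.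
    by rewrite first_rcons h w /= f23 f26 subn1.
  have {}w : wrong i (m, a) = false by case: wrong w.
  apply/wp_skip/Pf; rewrite ?f3 //; split; rewrite !f3 // gridS.
    by rewrite has_rcons w f20.
  by rewrite first_rcons w andbF.
move=> s1 [[k1 m1 o1] [f24 f23 f26 f]] _; apply: HQ => //.
by rewrite -grid_row.
Qed.

Lemma wp_SEARCH s c i Q : params n c i s -> W <= Z -> p * v <= Z -> v <= Z ->
  D <= Z -> B <= Z -> pos L v b i * D <= Z -> period R v i.+1 <= Z ->
  ram_mem s = (fun=> 0) ->
  (forall s', ram_out s' = ram_out s -> ram_reg s' 5 = W ->
     (ram_reg s' 21, ram_reg s' 22) = first (wrong i) (grid B D 0) -> Q s') ->
  wp Z b SEARCH s Q.
Proof.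
move=> Ps WZ pZ vZ DZ BZ NZ EZ m0 HQ.
apply/wp_seq/(wp_ADVANCE Ps) => // s1 m1 o1 A1.
apply/wp_seq/(wp_SKIP A1) => //; first by rewrite m1.
move=> s3 k3 o3 m3; have A3 := advanced_keeps (k := 16) isT A1 k3.
do 5 apply/wp_seq/wp_set.
apply: (@wp_loop _ _ (fun m s4 => [/\ advanced c i s4, ram_mem s4 = truth i m,
  ram_out s4 = ram_out s, ram_reg s4 23 = m & found (wrong i) (grid B m 0) s4]) D) => //.
- by rewrite /= (A3 3 isT).
- split=> //=.
  + by move=> r r15; rewrite /= !ifN ?A3 //; lia.
  + by rewrite o3.
- move=> m s4 mD [A4 m4 o4 e23 [e20 e21]] c4.
  set s5 := setr s4 16 _; have A5 : advanced c i s5.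
    by move=> r r15; rewrite /= ifN ?A4 //; lia.
  apply/wp_seq/(wp_RUN_truth A5 EZ (m := m)) => // s6 k6 o6 m6.
  have A6 := advanced_keeps (k := 38) isT A5 k6.
  apply/wp_seq/wp_set; set s7 := setr s6 23 _.
  have A7 : advanced c i s7 by move=> r r15; rewrite /= ifN ?A6 //; lia.
  have f23 : ram_reg s7 23 = m.+1 by rewrite /= (k6 23 isT) /= e23 addn1.
  apply: wp_seq.
  have Pf lm : lm = right_end i m ->
      wp Z b ROW (setr (setr s7 24 lm.1) 25 lm.2) (fun s2 =>
       [/\ advanced c i s2, ram_mem s2 = truth i m.+1, ram_out s2 = ram_out s,
        ram_reg s2 23 = m.+1 & found (wrong i) (grid B m.+1 0) s2] /\
        ram_reg s2 16 = D - m.+1).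
    move=> ->; set s8 := setr _ 25 _.
    have A8 : advanced c i s8 by move=> r r15; rewrite /= !ifN ?A6 //; lia.
    apply: (wp_ROW A8 (m := m)) => //=.
    + by case: right_end.
    + by split; rewrite /= !k6.
    + move=> s9 k9 m9 o9 g23 f9; split; last by rewrite (k9 16 isT) /= (k6 16 isT).
      split=> //; first exact: advanced_keeps A8 k9.
        by rewrite m9.
      by rewrite o9 /= o6.
  have g23 : ram_eval b s7 (EReg 23) = m.+1 := f23.
  have g3 : ram_eval b s7 (EReg 3) = D := A7 3 isT.
  apply: wp_if => /eqP; rewrite eval_ENe g23 g3 => mD'.
    apply/wp_seq/wp_set/wp_set; move: (Pf (2 + 2 * i.+1, m.+1)).
    rewrite /right_end (negbTE mD') /= => /(_ erefl).
    have -> : ram_reg s6 8 = i.+1 := A6 8 isT.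
    by rewrite addn1 -e23 (k6 23 isT) mul2n -addnn.
  apply/wp_seq/wp_set/wp_set; move: (Pf (hi L v b i)).
  rewrite /right_end mD' /= => /(_ erefl).
  have -> : ram_reg s6 13 = (hi L v b i).1 := A6 13 isT.
  by have -> : ram_reg s6 14 = (hi L v b i).2 := A6 14 isT.
move=> s4 [A4 m4 o4 _ [_ e21]] _; apply: HQ => //; exact: (A4 5 isT).
Qed.

(** By time [2 ^ (R * v)] the machine has halted, so this compares the [j]-th symbols of the correct
    and the proposed solution, a missing bit counting as a symbol. *)
Definition missed (j : nat) : bool := conf j (2 ^ (R * v)) 4 != 2 - board_read b 1 j.

(** Clearing [B] cells is enough: configurations vanish beyond them, by [conf_blank]. *)
Definition CLEAR : prog :=
  PSet 18 (ELit 0) ;; PSet 19 (EReg 4) ;;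
  Loop 19 (PStore (EReg 18) (ELit 0) ;; PSet 18 (EAdd (EReg 18) (ELit 1))).

(** A run captures a single output bit, so each [j] requires a fresh simulation on a cleared memory.
    Overwriting register 21 retains the last suitable [j]; any would do. *)
Definition CAPTURE : prog :=
  PSet 21 (ELit 0) ;; PSet 22 (ELit 0) ;; PSet 6 (ELit 0) ;;
  PSet 16 (EAdd (EReg 10) (ELit 1)) ;;
  Loop 16
    (CLEAR ;; RUN ;;
     PIf (ENe (ELoad (ELit 4)) (ESub (ELit 2) (ERead (ELit 1) (EReg 6))))
       (PSet 21 (EReg 6)) PSkip ;;
     PSet 6 (EAdd (EReg 6) (ELit 1))).

Lemma wp_CLEAR s Q : ram_reg s 4 <= Z ->
  (forall a, ram_reg s 4 <= a -> ram_mem s a = 0) ->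
  (forall s', (forall r, r != 18 -> r != 19 -> ram_reg s' r = ram_reg s r) ->
     ram_out s' = ram_out s -> ram_mem s' = (fun=> 0) -> Q s') ->
  wp Z b CLEAR s Q.
Proof.
move=> BZ m0 HQ; do 2 apply/wp_seq/wp_set.
apply: (@wp_loop _ _ (fun i s1 => [/\
  forall r, r != 18 -> r != 19 -> ram_reg s1 r = ram_reg s r,
  ram_out s1 = ram_out s, ram_reg s1 18 = i & forall a, ram_mem s1 a =
    if a < i then 0 else ram_mem s a]) (ram_reg s 4)) => //.
- by split=> // r /negbTE r18 /negbTE r19; rewrite /= r19 r18.
- move=> i s1 iB [k1 o1 e1 m1] c1; apply/wp_seq/wp_store/wp_set; split=> //.
  split=> //= [r r18 r19||a].
  + by rewrite (negbTE r18) (negbTE r19) k1.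
  + by rewrite e1 addn1.
  + by rewrite e1 m1 ltnS [a <= i]leq_eqVlt; case: eqP.
move=> s1 [k1 o1 _ m1] _; apply: HQ => //; apply: funext => a.
by rewrite m1; case: ltnP => // /m0.
Qed.

Lemma wp_CAPTURE s c Q : params n c 0 s -> W <= Z -> B <= Z ->
  2 ^ (R * v) < Z ->
  (forall j a, B <= a -> conf j (2 ^ (R * v)) a = 0) ->
  ram_mem s = (fun=> 0) ->
  (forall s', ram_out s' = ram_out s -> ram_reg s' 5 = W ->
     ram_reg s' 21 = last 0 [seq j <- mkseq id (2 ^ (R * v)).+1 | missed j] ->
     ram_reg s' 22 = 0 -> Q s') ->
  wp Z b CAPTURE s Q.
Proof.
move=> Ps WZ BZ TZ c0 m0 HQ; do 4 apply/wp_seq/wp_set.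
have e10 : ram_reg s 10 = 2 ^ (R * v) by rewrite (Ps 10 isT) /= /period divn1.
apply: (@wp_loop _ _ (fun j s1 => [/\ [/\ ram_reg s1 0 = n, ram_reg s1 4 = B,
   ram_reg s1 5 = W & ram_reg s1 10 = 2 ^ (R * v)],
   ram_reg s1 6 = j, ram_reg s1 21 = last 0 [seq i <- mkseq id j | missed i] /\
   ram_reg s1 22 = 0, ram_out s1 = ram_out s &
   forall a, B <= a -> ram_mem s1 a = 0]) (2 ^ (R * v)).+1) => //.
- by rewrite /= e10 addn1.
- split=> //=; last by rewrite m0.
  by split=> //; [exact: (Ps 0 isT)|exact: (Ps 4 isT)|exact: (Ps 5 isT)].
- move=> j s1 jT [[e0 e4 e5 f10] e6 [e21 e22] o1 m1] c1.
  set s1' := setr s1 16 _; have e4' : ram_reg s1' 4 = B := e4.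
  apply/wp_seq/wp_CLEAR; rewrite ?e4' // => s2 k2 o2 m2.
  apply/wp_seq/wp_RUN; first by rewrite k2 //= f10 ltnW.
  move=> s3 k3 o3 m3.
  have {}m3 : ram_mem s3 = conf j (2 ^ (R * v)).
    by rewrite m3 !k2 //= f10 e0 e6 m2.
  have g r : r < 18 -> r != 16 -> ram_reg s3 r = ram_reg s1 r.
    move=> r18 r16; rewrite k3 1?k2 /= ?(negbTE r16) //; lia.
  have g21 : ram_reg s3 21 = ram_reg s1 21 by rewrite k3 // k2.
  have g22 : ram_reg s3 22 = ram_reg s1 22 by rewrite k3 // k2.
  have g16 : ram_reg s3 16 = (2 ^ (R * v)).+1 - j.+1 by rewrite k3 // k2.
  apply: wp_seq; apply: wp_if => /eqP; rewrite eval_ENe [X in X == _]/=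
      [X in _ == X]/= m3 g // e6 => mj.
    apply/wp_set/wp_set; rewrite mkseqS filter_rcons ifT //.
    split=> //=; rewrite last_rcons g22 !g //; split=> //.
    + by rewrite e6 addn1.
    + by rewrite o3 o2.
    + by rewrite m3 => a /c0.
  apply/wp_skip/wp_set; rewrite mkseqS filter_rcons ifF; last first.
    by rewrite /missed mj.
  split=> //=; rewrite g21 g22 !g //; split=> //.
  + by rewrite e6 addn1.
  + by rewrite o3 o2.
  + by rewrite m3 => a /c0.
by move=> s1 [[_ _ e5 _] _ [e21 e22] o1 _] _; exact: HQ.
Qed.

Definition CHALLENGER : prog :=
  PRE K p q R L ;; PIf (EHalf (EReg 1)) SEARCH CAPTURE ;;
  PSet 34 (EReg 21) ;; EMITW ;; PSet 34 (EReg 22) ;; EMITW.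

(** One format for all rounds: the second word is the address of a wrong cell, which the miner reads
    only in the last round, and a dummy 0 next to [j]. *)
Definition dispute (c : nat) : seq nat :=
  if c./2 == 0 then [:: last 0 [seq j <- mkseq id (2 ^ (R * v)).+1 | missed j]; 0]
  else let da := first (wrong (c./2).-1) (grid B D 0) in [:: da.1; da.2].

Lemma wp_CHALLENGER s c Q : ram_reg s 0 = n -> ram_reg s 1 = c ->
  ram_mem s = (fun=> 0) ->
  W <= Z -> p * v <= Z -> R * v <= Z -> v <= Z -> (c./2).-1 <= Z ->
  D <= Z -> B <= Z -> 2 ^ (R * v) < Z ->
  pos L v b (c./2).-1 * D <= Z -> period R v (c./2).-1.+1 <= Z ->
  (forall j a, B <= a -> conf j (2 ^ (R * v)) a = 0) ->
  (forall s', ram_out s' = ram_out s ++ words W (dispute c) -> Q s') ->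
  wp Z b CHALLENGER s Q.
Proof.
move=> s0 s1 m0 WZ pZ RZ vZ cZ DZ BZ TZ NZ EZ c0 HQ.
apply/wp_seq/(wp_PRE q_gt0 s0 s1) => // s2 m2 o2 Ps.
have mm : ram_mem s2 = (fun=> 0) by rewrite m2.
have c2 : ram_reg s2 1 = c := Ps 1 isT.
have E s3 : ram_out s3 = ram_out s2 -> ram_reg s3 5 = W ->
    dispute c = [:: ram_reg s3 21; ram_reg s3 22] ->
    wp Z b (PSet 34 (EReg 21) ;; EMITW ;; PSet 34 (EReg 22) ;; EMITW) s3 Q.
  move=> o3 e5 e; apply/wp_seq/wp_set/wp_seq.
  apply: (@wp_EMITW _ _ _ W) => // s4 k4 m4 o4; apply/wp_seq/wp_set.
  apply: (@wp_EMITW _ _ _ W) => //=; first by rewrite (k4 5 isT).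
  move=> s5 k5 m5 o5; apply: HQ; rewrite o5 /= o4 /= o3 o2 e /words /= cats0.
  by rewrite (k4 22 isT) catA.
apply: wp_seq; apply: wp_if; rewrite /= c2 => /eqP h.
  apply: (wp_SEARCH Ps) => // s3 o3 e5 e; apply: E => //.
  by rewrite /dispute (negbTE h) -e.
rewrite (eqP h) in Ps; apply: (wp_CAPTURE Ps) => // s3 o3 e5 e21 e22; apply: E => //.
by rewrite /dispute h e21 e22.
Qed.

(* The miner copies into its memory only those cells of the left end on which
   the cell at the disputed address depends, and simulates a step there. *)
Definition FETCH (a : expr) : prog :=
  (PSet 30 (EReg 11) ;; PSet 31 (EReg 12) ;; PSet 32 a ;; CLAIM) ;;
  PStore a (EReg 33).

Definition MINER : prog :=
  PRE K p q R L ;;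
  PIf (ENe (EReg 1) (ELit (2 * R.+1))) PSkip
    (PSet 34 (ELit (3 + 2 * R)) ;; PSet 35 (ELit 1) ;; WORD ;;
     PSet 16 (ESub (EReg 36) (ESub (EReg 36) (ESub (EReg 4) (ELit 1)))) ;;
     FETCH (ELit 0) ;; FETCH (ELit 1) ;; FETCH (ELit 2) ;; FETCH (ELit 3) ;;
     FETCH (ELit 4) ;; FETCH (EAdd (ELit 5) (ELoad (ELit 2))) ;;
     FETCH (EReg 16) ;; SIM M ;;
     (PSet 30 (EReg 13) ;; PSet 31 (EReg 14) ;; PSet 32 (EReg 16) ;; CLAIM) ;;
     PIf (ENe (EReg 33) (ELoad (EReg 16))) (PEmit (ELit 0)) (PEmit (ELit 1))).

Definition address : nat := minn (word W b (3 + 2 * R) 1) B.-1.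

Definition consistent : bool :=
  claimed (hi L v b R) address == stepf M b n j0 (claimed (lo L v b R)) address.

(** The transition is determined by the state, the head positions and the symbols under the heads. A
    new cell therefore depends on the five header cells, the scanned work cell and its own old
    value. *)
Lemma stepf_local j c c' a :
  (forall i, i < 5 -> c i = c' i) -> c (5 + c 2) = c' (5 + c 2) -> c a = c' a ->
  stepf M b n j c a = stepf M b n j c' a.
Proof.
move=> h5 hw ha; rewrite /stepf hw !h5 //.
case: trans => [[[[? ?] ?] ?] ?]; case: eqP => // _.
by case: a ha => [|[|[|[|[|a]]]]].
Qed.

(** [xs] lists the addresses fetched before. Repetitions among them are harmless, since the value
    stored depends on the address only. *)
Lemma wp_FETCH xs a s c Q : params n c R s -> W <= Z -> p * v <= Z ->
  (forall s1, pures 30 s s1 -> ram_eval b s1 a = ram_eval b s a) ->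
  (forall i, i \in xs -> ram_mem s i = claimed (lo L v b R) i) ->
  (forall s', params n c R s' -> ram_reg s' 16 = ram_reg s 16 ->
     ram_out s' = ram_out s ->
     (forall i, i \in ram_eval b s a :: xs ->
        ram_mem s' i = claimed (lo L v b R) i) -> Q s') ->
  wp Z b (FETCH a) s Q.
Proof.
move=> Ps WZ pZ ea mx HQ; apply/wp_seq/wp_claimed => //.
  by split; [exact: (Ps 3 isT)|exact: (Ps 5 isT)|exact: (Ps 6 isT)|exact: (Ps 7 isT)].
move=> s1 P1; rewrite (Ps 11 isT) (Ps 12 isT) [nth _ _ 11]/= [nth _ _ 12]/=.
rewrite -surjective_pairing => e33; have [k1 m1 o1] := P1.
have {}e33 : ram_eval b s1 (EReg 33) = _ := e33.
apply: wp_store; rewrite (ea s1) // e33; apply: HQ => //.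
- exact: params_keeps Ps k1.
- exact: (k1 16 isT).
- move=> i; rewrite inE /= m1; case: eqP => [->|_] //; exact: mx.
Qed.

Lemma wp_MINER s c Q : ram_reg s 0 = n -> ram_reg s 1 = c ->
  ram_mem s = (fun=> 0) -> ram_out s = [::] ->
  W <= Z -> p * v <= Z -> R * v <= Z -> v <= Z -> (c./2).-1 <= Z ->
  (forall s', ram_out s' = (if c == 2 * R.+1 then [:: consistent] else [::]) ->
     Q s') ->
  wp Z b MINER s Q.
Proof.
move=> s0 s1 m0 o0 WZ pZ RZ vZ cZ HQ.
apply/wp_seq/(wp_PRE q_gt0 s0 s1) => // s2 m2 o2 Ps.
have c2 : ram_eval b s2 (EReg 1) = c := Ps 1 isT.
apply: wp_if => /eqP; rewrite eval_ENe c2 [X in _ == X]/= => cR.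
  by apply/wp_skip/HQ; rewrite o2 o0 (negbTE cR).
(* With all [2 * R.+1] messages on the board, the pointers are those after round [R]. *)
rewrite cR in HQ; move/eqP in cR; have {}cR : (c./2).-1 = R by lia.
rewrite {}cR in Ps.
do 2 apply/wp_seq/wp_set; apply/wp_seq/(@wp_WORD _ _ _ W) => //=.
  exact: (Ps 5 isT).
move=> s3 [k3 m3 o3] e36; apply/wp_seq/wp_set; set s4 := setr _ 16 _.
have P4 : params n c R s4.
  move=> r r15; rewrite /= ifN; last by lia.
  rewrite k3 /= ?ifN; [exact: Ps|lia..].
have e16 : ram_reg s4 16 = address.
  by rewrite /= e36 (k3 4 isT) /= (Ps 4 isT) /= subn1 min_sub.
have o4 : ram_out s4 = [::] by rewrite /= o3 /= o2.
move: s4 P4 e16 o4 => s4 P4 e16 o4 {s3 k3 m3 o3 e36 Ps s2 m2 o2 c2}.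
have X i s5 s6 : ram_eval b s6 (ELit i) = ram_eval b s5 (ELit i) by [].
apply/wp_seq/(@wp_FETCH [::] _ _ _ _ P4) => // s5 P5 e5 o5 m5.
apply/wp_seq/(@wp_FETCH _ _ _ _ _ P5 _ _ _ m5) => // s6 P6 e6 o6 m6.
apply/wp_seq/(@wp_FETCH _ _ _ _ _ P6 _ _ _ m6) => // s7 P7 e7 o7 m7.
apply/wp_seq/(@wp_FETCH _ _ _ _ _ P7 _ _ _ m7) => // s8 P8 e8 o8 m8.
apply/wp_seq/(@wp_FETCH _ _ _ _ _ P8 _ _ _ m8) => // s9 P9 e9 o9 m9.
apply/wp_seq/(@wp_FETCH _ _ _ _ _ P9 _ _ _ m9) => //.
  by move=> s' [_ ms _]; rewrite /= ms.
move=> s10 P10 e10 o10 m10.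
apply/wp_seq/(@wp_FETCH _ _ _ _ _ P10 _ _ _ m10) => //.
  by move=> s' [ks _ _]; rewrite /= ks.
move=> s11 P11 e11 o11 m11.
have f16 : ram_reg s10 16 = address by rewrite e10 e9 e8 e7 e6 e5.
have g16 : ram_reg s11 16 = address by rewrite e11.
have {}o11 : ram_out s11 = [::] by rewrite o11 o10 o9 o8 o7 o6 o5.
have m92 : ram_mem s9 2 = claimed (lo L v b R) 2 by apply: m9; rewrite !inE.
rewrite [ram_eval _ s10 _]/= f16 [ram_eval _ s9 _]/= m92 /= in m11.
apply: wp_seq; apply: wp_SIM => s12 k12 o12.
have -> : ram_reg s11 0 = n := P11 0 isT.
have -> : ram_reg s11 6 = j0 := P11 6 isT.
move=> m12; have P12 : params n c R s12 by apply: params_keeps P11 k12.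
apply/wp_seq/wp_claimed => //.
- by split; [exact: (P12 3 isT)|exact: (P12 5 isT)|exact: (P12 6 isT)|exact: (P12 7 isT)].
- by move=> s' [ks _ _]; rewrite /= (ks 16 isT).
move=> s13 P13; rewrite (P12 13 isT) (P12 14 isT) [nth _ _ 13]/= [nth _ _ 14]/=.
rewrite -surjective_pairing /= (k12 16 isT) g16 => e33; have [k13 m13 o13] := P13.
have E : stepf M b n j0 (ram_mem s11) address =
    stepf M b n j0 (claimed (lo L v b R)) address.
  have m11i i : i < 5 -> ram_mem s11 i = claimed (lo L v b R) i.
    by move=> i5; apply: m11; rewrite !inE; do 5 (case: i i5 => [|i] i5; rewrite ?orbT //).
  apply: stepf_local => //.
  - by rewrite (m11i 2 isT); apply: m11; rewrite !inE eqxx orbT.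
  - by apply: m11; rewrite inE eqxx.
have ne : (ram_eval b s13 (EReg 33) == ram_eval b s13 (ELoad (EReg 16))) = consistent.
  by rewrite /= e33 m13 m12 (k13 16 isT) (k12 16 isT) g16 E.
apply: wp_if => /eqP; rewrite eval_ENe ne => h; apply/wp_emit/HQ => /=;
  by rewrite o13 o12 o11 ?h ?(negbTE h).
Qed.

End Players.

(** * Computations *)

Section Encoding.
Variables (M : TM) (x : seq bool) (b : seq (seq bool)) (j : nat).
Hypothesis b0 : nth [::] b 0 = x.
Local Notation n := (size x).

Definition encode (c : config M) : nat -> nat := fun a =>
  match a with
  | 0 => code (tm_start M) (cf_state c)
  | 1 => cf_input_pos c
  | 2 => cf_work_pos c
  | 3 => size (cf_output c)
  | 4 => bit_code (onth (cf_output c) j)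
  | a'.+4.+1 => code (tm_blank M) (nth (tm_blank M) (cf_tape c) a')
  end.

Lemma encode_init : encode (tm_init M) = fun=> 0.
Proof.
apply: funext => a; case: a => [|[|[|[|[|a]]]]] /=;
  by rewrite ?onth0n ?nth_nil ?code0.
Qed.

Lemma input_decode_at i : input_decode (input_at b i) = Some (read_input x i).
Proof.
rewrite /input_at /read_input; case: i => //= i; rewrite /board_read b0.
by case: (onth x i) => [[]|].
Qed.

(** In a halting configuration the neutral transition of [trans] still clamps the input head; the
    hypothesis ensures that this does not move it. *)
Lemma encode_step c : cf_input_pos c <= n.+1 ->
  stepf M b n j (encode c) = encode (tm_step x c).
Proof.
move=> cn; rewrite /tm_step /tm_next /stepf /trans input_decode_at.
rewrite [encode c (5 + _)]/= [encode c 0]/= !onth_code.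
apply: funext => a.
case E: (tm_delta _ _ _) => [[[[[q di] w] dw] o]|]; last first.
  case: eqP => [->|_] //; case: a => [|[|[|[|[|a]]]]] //=.
  - by rewrite addn1 /=; apply/minn_idPl.
  - by rewrite addn1.
  - by rewrite addn0.
have oo : (bit_code o != 0) = isSome o by case: o {E} => [[]|].
case: a => [|[|[|[|[|a]]]]] //=.
- by rewrite moveE.
- by rewrite moveE.
- by rewrite oo size_cat; case: o {E oo}.
- rewrite oo onth_cat; case: o {E oo} => [z|] /=; last first.
    by case: ltnP => // h; rewrite onth_default ?onth0n.
  case: (ltngtP j (size (cf_output c))) => // [h|->]; last by rewrite subnn.
  rewrite onth_default; last exact: ltnW.
  by rewrite onth_default // subn_gt0.
- by rewrite nth_set_nth /= eqSS !eqSS; case: eqP.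
Qed.

Lemma input_pos_le i : cf_input_pos (tm_run M x i) <= n.+1.
Proof.
elim: i => //= i IH; rewrite /tm_step; case: tm_next => [[[[[? ?] ?] ?] ?]|] //=.
exact: geq_minr.
Qed.

Lemma confE i : conf M b n j i = encode (tm_run M x i).
Proof.
elim: i => [|i IH]; first by rewrite encode_init.
by rewrite /conf iterS -/(conf M b n j i) IH encode_step ?input_pos_le.
Qed.

Variables (y : seq bool) (t s : nat).
Hypothesis compute : tm_computes M x y t s.

Lemma run_halted i i0 : tm_next x (tm_run M x i0) = None ->
  tm_run M x (i + i0) = tm_run M x i0.
Proof.
move=> h; elim: i => // i IH.
by rewrite addSn [LHS]/= -/(tm_run M x (i + i0)) IH /tm_step h.
Qed.

(** The disputed computation goes on to time [2 ^ (R * v)], usually long after halting. Since the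
    configuration is then frozen, each one occurs at a time for which the bounds on time and space
    hold. *)
Lemma run_bounded i : exists i', [/\ i' <= t, tm_run M x i = tm_run M x i',
  (t <= i -> cf_output (tm_run M x i) = y) &
  forall k, k <= i' -> cf_work_pos (tm_run M x k) < s].
Proof.
have [i0 [i0t h e ws]] := compute.
case: (leqP i0 i) => ii0.
  exists i0; have E : tm_run M x i = tm_run M x i0.
    by rewrite -(subnK ii0) run_halted.
  by split=> // _; rewrite E.
exists i; split=> //; first by rewrite (leq_trans (ltnW ii0)).
  by move=> ti; lia.
by move=> k ki; apply: ws; rewrite (leq_trans ki) // ltnW.
Qed.

Lemma size_output_le i : size (cf_output (tm_run M x i)) <= i.
Proof.
elim: i => //= i IH; rewrite /tm_step; case: tm_next => [[[[[? ?] ?] ?] o]|] /=.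
  rewrite size_cat; case: o => [?|] /=; last by rewrite addn0 leqW.
  by rewrite addn1.
exact: leqW.
Qed.

Lemma size_tape_le i : (forall k, k <= i -> cf_work_pos (tm_run M x k) < s) ->
  size (cf_tape (tm_run M x i)) <= s.
Proof.
elim: i => //= i IH ws; have {}IH : size (cf_tape (tm_run M x i)) <= s.
  by apply: IH => k ki; apply: ws; exact: leqW.
rewrite /tm_step; case: tm_next => [[[[[? ?] ?] ?] o]|] //=.
by rewrite size_set_nth geq_max IH andbT ws.
Qed.

Lemma conf_work_pos i : conf M b n j i 2 < s.
Proof.
by rewrite confE; have [i' [_ -> _ ws]] := run_bounded i; exact: ws.
Qed.

Lemma conf_blank i a : 5 + s <= a -> conf M b n j i a = 0.
Proof.
rewrite confE; have [i' [_ -> _ ws]] := run_bounded i.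
case: a => [|[|[|[|[|a]]]]] //= sa; rewrite nth_default ?code0 //.
by rewrite (leq_trans (size_tape_le ws)).
Qed.

Lemma conf_captured i : t <= i -> conf M b n j i 4 = bit_code (onth y j).
Proof. by rewrite confE; have [i' [_ _ + _]] := run_bounded i => /[apply] /= ->. Qed.

Lemma output_le : size y <= t.
Proof.
have [i0 [i0t h <- _]] := compute; exact: leq_trans (size_output_le _) i0t.
Qed.

Lemma conf_lt i a N : size (states M) <= N -> size (symbols M) <= N ->
  n.+2 < N -> s <= N -> t < N -> conf M b n j i a < N.
Proof.
move=> stN syN nN sN tN; have N2 : 2 < N by lia.
rewrite confE; have [i' [i't -> _ ws]] := run_bounded i.
case: a => [|[|[|[|[|a]]]]] /=.
- exact: leq_trans (code_lt _ _) stN.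
- exact: leq_ltn_trans (input_pos_le _) (ltnW nN).
- exact: leq_trans (ws _ _) sN.
- by apply: leq_ltn_trans tN; apply: leq_trans i't; exact: size_output_le.
- by case: onth => [[]|] /=; lia.
- exact: leq_trans (code_lt _ _) syN.
Qed.

End Encoding.

(** * Correctness *)

Lemma size_rows (F : nat -> nat -> nat) N k :
  size (flatten (mkseq (fun m => mkseq (F m) N) k)) = k * N.
Proof.
elim: k => // k IH.
by rewrite mkseqS flatten_rcons size_cat IH size_mkseq mulSn addnC.
Qed.

Lemma nth_rows (F : nat -> nat -> nat) N k m a : m < k -> a < N ->
  nth 0 (flatten (mkseq (fun m => mkseq (F m) N) k)) (m * N + a) = F m a.
Proof.
move=> mk aN; elim: k mk => // k IH.
rewrite ltnS leq_eqVlt mkseqS flatten_rcons nth_cat size_rows.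
move=> /predU1P[->|mk]; first by rewrite ltnNge leq_addr addKn nth_mkseq.
rewrite ifT ?IH //; apply: (@leq_trans (m.+1 * N)).
  by rewrite mulSn addnC ltn_add2r.
by rewrite leq_mul2r mk orbT.
Qed.

Lemma mem_grid N m a m' a' : a <= N ->
  ((m', a') \in grid N m a) = (m' < m) && (a' < N) || (m' == m) && (a' < a).
Proof.
move=> aN; elim: m a aN => [|m IH].
  elim=> [|a IHa] aN; first by rewrite andbF.
  rewrite gridS mem_rcons inE (IHa (ltnW aN)) xpair_eqE /=.
  by rewrite [a' < a.+1]ltnS [a' <= a]leq_eqVlt; case: (m' == 0); case: eqP.
elim=> [|a IHa] aN.
  rewrite -grid_row IH // ltn0 andbF orbF ltnS (leq_eqVlt m').
  by rewrite -andb_orl orbC.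
rewrite gridS mem_rcons inE (IHa (ltnW aN)) xpair_eqE /=.
rewrite [a' < a.+1]ltnS [a' <= a]leq_eqVlt.
by case: (m' < _); case: (a' < N); case: eqP; case: eqP.
Qed.

Lemma first_grid (P : nat * nat -> bool) N m a : a <= N -> has P (grid N m a) ->
  [/\ P (first P (grid N m a)), first P (grid N m a) \in grid N m a &
   forall m' a', m' < (first P (grid N m a)).1 -> a' < N -> ~~ P (m', a')].
Proof.
elim: m a => [|m IH].
  elim=> [|a IHa] aN //; rewrite gridS has_rcons first_rcons mem_rcons inE.
  case h: (has P _) => /=; last first.
    rewrite orbF => Pa; rewrite Pa eqxx; split=> // m' a'.
  by have [] := IHa (ltnW aN) h => ? ? ? _; split=> //; apply/orP; right.
elim=> [|a IHa] aN; first by rewrite -grid_row; exact: IH.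
rewrite gridS has_rcons first_rcons mem_rcons inE.
case h: (has P _) => /=; last first.
  rewrite orbF => Pa; rewrite Pa eqxx; split=> // m' a' /= m'm a'N.
  apply/negP => Pm; move/negbT/hasPn: h => /(_ (m', a')).
  by rewrite (mem_grid m.+1 m' a' (ltnW aN)) m'm a'N Pm => /(_ isT).
by have [] := IHa (ltnW aN) h => ? ? ? _; split=> //; apply/orP; right.
Qed.

(** * What depends only on a prefix of the board *)

Section Locality.
Variables (M : TM) (K p q R L n : nat) (b b' : seq (seq bool)).

Local Notation v := (scale K q n).

(** A player computes a message from the board of that moment, whereas the verdict concerns the
    final board. Agreement on a prefix carries the one over to the other. *)
Definition same_upto (k : nat) : Prop :=
  forall e, e < k -> nth [::] b e = nth [::] b' e.

Lemma same_upto_le k l : k <= l -> same_upto l -> same_upto k.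
Proof. by move=> kl h e ek; apply: h; exact: leq_trans kl. Qed.

Lemma word_same k W e i : same_upto k -> e < k -> word W b e i = word W b' e i.
Proof. by move=> h ek; apply: eq_wval => c; rewrite !board_readE h. Qed.

Lemma digit_same i : same_upto (4 + 2 * i) -> digit L v b i = digit L v b' i.
Proof. by move=> h; rewrite /digit (word_same _ _ h). Qed.

Lemma pos_same i : same_upto (4 + 2 * i) -> pos L v b i = pos L v b' i.
Proof.
elim: i => //= i IH h; rewrite IH ?digit_same //.
by apply: same_upto_le h; lia.
Qed.

Lemma hi_same i : same_upto (4 + 2 * i) -> hi L v b i = hi L v b' i.
Proof.
elim: i => //= i IH h; rewrite IH ?digit_same //.
by apply: same_upto_le h; lia.
Qed.

Lemma hi_entry i : (hi L v b i).1 <= 4 + 2 * i.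
Proof.
by elim: i => //= i IH; case: ifP => _ /=; lia.
Qed.

Lemma conf_same j i : same_upto 1 -> conf M b n j i = conf M b' n j i.
Proof.
move=> h; rewrite /conf; elim: i => //= i ->.
by rewrite /stepf /input_at /board_read h.
Qed.

Lemma truth_same i m : same_upto (4 + 2 * i) ->
  truth M K q R L b n i m = truth M K q R L b' n i m.
Proof.
move=> h; rewrite /truth pos_same // (word_same _ _ h) //; apply: conf_same.
exact: same_upto_le h.
Qed.

Lemma claimed_same k lm a : same_upto k -> lm.1 < k -> 3 < k ->
  claimed K p q L b n lm a = claimed K p q L b' n lm a.
Proof.
move=> h lk k3; rewrite /claimed /claim !(word_same _ _ h) //.
by rewrite /board_read h //; lia.
Qed.

Lemma wrong_same i ma : same_upto (5 + 2 * i) ->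
  wrong M K p q R L b n i ma = wrong M K p q R L b' n i ma.
Proof.
move=> h; have h' : same_upto (4 + 2 * i) by apply: same_upto_le h; lia.
rewrite /wrong truth_same // /right_end hi_same //; congr (_ != _).
apply: (claimed_same _ h); last by lia.
by rewrite -hi_same //; case: ifP => _ /=; have := hi_entry i; lia.
Qed.

Lemma missed_same j : same_upto 2 ->
  missed M K q R b n j = missed M K q R b' n j.
Proof.
move=> h; rewrite /missed conf_same; last exact: same_upto_le h.
by rewrite /board_read h.
Qed.

Lemma claims_same i : same_upto (4 + 2 * i) ->
  claims M K p q R L b n i = claims M K p q R L b' n i.
Proof.
by move=> h; congr flatten; apply: eq_mkseq => m; rewrite truth_same.
Qed.

Lemma dispute_same c : same_upto (3 + 2 * c./2) ->
  dispute M K p q R L b n c = dispute M K p q R L b' n c.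
Proof.
move=> h; rewrite /dispute; case: eqP => c0.
  congr [:: last 0 _; 0]; apply: eq_filter => j; apply: missed_same.
  exact: same_upto_le h.
have -> : first (wrong M K p q R L b n (c./2).-1) =1
    first (wrong M K p q R L b' n (c./2).-1).
  move=> l; congr head; apply: eq_filter => ma; apply: wrong_same.
  by apply: same_upto_le h; lia.
by [].
Qed.

End Locality.

(** * The verdict when one of the players is honest *)

Section Core.
Variables (M : TM) (K p q R L : nat) (x S y : seq bool) (t s : nat).
Variable b : seq (seq bool).
Local Notation n := (size x).
Local Notation v := (scale K q n).
Local Notation D := (2 ^ v).
Local Notation B := (2 ^ (p * v)).
Local Notation W := (L * v).
Local Notation j0 := (word W b 3 0).
Local Notation pos := (pos L v b).
Local Notation period := (period R v).
Local Notation V i := (conf M b n j0 i).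
Local Notation lo := (lo L v b).
Local Notation hi := (hi L v b).
Local Notation claimed := (claimed K p q L b n).

Hypothesis compute : tm_computes M x y t s.
Hypothesis tT : t <= 2 ^ (R * v).
Hypothesis sB : 5 + s <= B.
Hypothesis stW : size (states M) <= 2 ^ W.
Hypothesis syW : size (symbols M) <= 2 ^ W.
Hypothesis nW : n.+2 < 2 ^ W.
Hypothesis v_gt0 : 0 < v.
Hypothesis R_gt0 : 0 < R.
Hypothesis pRL : p + R < L.
Hypothesis b0 : nth [::] b 0 = x.
Hypothesis b1 : nth [::] b 1 = S.

Lemma exp_mul_lt k : k < L -> 2 ^ (k * v) < 2 ^ W.
Proof. by move=> kL; rewrite ltn_exp2l // ltn_pmul2r. Qed.

Lemma DltW : D < 2 ^ W.
Proof. by rewrite -{1}(mul1n v); apply: exp_mul_lt; lia. Qed.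

Lemma BltW : B < 2 ^ W.
Proof. by apply: exp_mul_lt; lia. Qed.

Lemma TltW : 2 ^ (R * v) < 2 ^ W.
Proof. by apply: exp_mul_lt; lia. Qed.

Lemma V_lt i a : V i a < 2 ^ W.
Proof.
apply: (conf_lt _ b0 compute) => //; first by have := BltW; lia.
by apply: leq_ltn_trans tT TltW.
Qed.

Lemma period_step i : i < R -> period i = D * period i.+1.
Proof.
move=> iR; have h : v + v * i <= R * v by rewrite -mulnS mulnC leq_mul2r iR orbT.
have h' : v * i <= R * v := leq_trans (leq_addl _ _) h.
rewrite /period -!expnM -!expnB ?mulnS //.
by rewrite -expnD; congr (2 ^ _); lia.
Qed.

Lemma period_last : period R = 1.
Proof. by rewrite /period -expnM mulnC divnn expn_gt0. Qed.

Lemma period0 : period 0 = 2 ^ (R * v).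
Proof. by rewrite /period divn1. Qed.

(** This explains the code [2 - b] of a bit: a position past the end reads 2 and gets the code 0 of
    an absent bit. *)
Lemma board_read_S j : 2 - board_read b 1 j = bit_code (onth S j).
Proof. by rewrite /board_read b1; case: (onth S j). Qed.

Lemma claimed_init a : claimed (lo 0) a = V 0 a.
Proof. by []. Qed.

Lemma claimed_entry i m a : m <= D -> (4 + 2 * i, m) != (4, D) ->
  claimed (4 + 2 * i, m) a = word W b (4 + 2 * i) (m * B + a).
Proof.
move=> mD ne; rewrite /claimed /claim /= ifF //; apply/negP => /and3P[i0 m0 _].
by move: ne; rewrite xpair_eqE i0 m0.
Qed.

(** The left end is known to be right only below [B]. This is enough, since the work head stays
    within the space bound and so every cell consulted is below [B]. *)
Lemma step_claimed i a : (forall a, a < B -> claimed (lo R) a = V i a) ->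
  a < B -> stepf M b n j0 (claimed (lo R)) a = V i.+1 a.
Proof.
move=> h aB; have w2 := conf_work_pos j0 b0 compute i.
rewrite /conf iterS -/(conf M b n j0 i); apply: stepf_local; last exact: h.
  by move=> k k5; apply: h; lia.
by rewrite !h; lia.
Qed.

Lemma addressB : address K p q R L b n < B.
Proof. by rewrite /address; have := expn_gt0 2 (p * v); lia. Qed.

Section Honest_prover.
Hypothesis Sy : S = y.
Hypothesis honest : forall i, i < R ->
  nth [::] b (4 + 2 * i) = words W (claims M K p q R L b n i).

Lemma word_claims i m a : i < R -> m <= D -> a < B ->
  word W b (4 + 2 * i) (m * B + a) = truth M K q R L b n i m a.
Proof.
move=> iR mD aB; have E : nth 0 (claims M K p q R L b n i) (m * B + a) =
    truth M K q R L b n i m a by rewrite nth_rows // ltnS.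
rewrite (word_words (honest iR)) ?E //; last exact: V_lt.
rewrite size_rows; apply: (@leq_trans (m.+1 * B)); last by rewrite leq_mul2r ltnS mD orbT.
by rewrite mulSn addnC ltn_add2r.
Qed.

Lemma claims_true i : i <= R -> forall a, a < B ->
  claimed (lo i) a = V (pos i * period i) a /\
  claimed (hi i) a = V ((pos i).+1 * period i) a.
Proof.
elim: i => [_|i IH iR] a aB.
  rewrite claimed_init; split=> //.
  (* Cell 4 at [(4, D)] is taken from the proposed solution and not from the message; it is true
     because [S = y]. *)
  rewrite mul1n period0 /claimed /claim /= eqxx /=; case: eqP => [->|_].
    by rewrite board_read_S Sy (conf_captured _ b0 compute tT).
  have := word_claims (i := 0) R_gt0 (leqnn D) aB.
  by rewrite /truth mul0n add0n -period_step // period0.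
have {IH}[IHl IHh] := IH (ltnW iR) a aB.
have dD := digit_lt L v b i.+1.
have E m : m < D -> claimed (4 + 2 * i, m) a = V ((pos i * D + m) * period i.+1) a.
  move=> mD; rewrite claimed_entry ?(ltnW mD) //.
    by rewrite word_claims // ltnW.
  by rewrite xpair_eqE [m == D]ltn_eqF // andbF.
have e4 : 2 + 2 * i.+1 = 4 + 2 * i by lia.
split=> /=; rewrite e4.
  case: eqP => [->|_]; last exact: E.
  by rewrite addn0 IHl period_step // mulnA.
case: eqP => [dE|/eqP dE]; last first.
  by rewrite E ?addnS // ltn_neqAle dE.
by rewrite IHh period_step // mulnA -addnS dE mulSn addnC.
Qed.

Lemma honest_consistent : consistent M K p q R L b n.
Proof.
have h := claims_true (leqnn R); apply/eqP.
rewrite (h _ addressB).2 (step_claimed (i := pos R * period R)) ?addressB //.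
  by rewrite period_last !muln1.
by move=> a /h[].
Qed.

End Honest_prover.

Section Honest_challenger.
Hypothesis Sy : S <> y.
Hypothesis capture : nth [::] b 3 = words W (dispute M K p q R L b n 1).
Hypothesis honest : forall i, i < R ->
  nth [::] b (5 + 2 * i) = words W (dispute M K p q R L b n (3 + 2 * i)).

(** Although [S] may be arbitrarily long, a bounded search suffices: [y] has length at most
    [2 ^ (R * v)], so if the symbols at all these [j] agree, [S] has no bit at position [size y] and
    ends there as well. *)
Lemma missed_exists : exists2 j, j <= 2 ^ (R * v) & missed M K q R b n j.
Proof.
have missE j : missed M K q R b n j = (bit_code (onth y j) != bit_code (onth S j)).
  by rewrite /missed board_read_S (conf_captured _ b0 compute tT).
have inj : injective bit_code by do 2 case=> [[]|].
case: (pselect (exists2 j, j <= 2 ^ (R * v) & missed M K q R b n j)) => // none.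
have same j : j <= 2 ^ (R * v) -> onth S j = onth y j.
  move=> jT; apply: inj; apply/esym/eqP; apply/negbNE; rewrite -missE.
  by apply/negP => mj; apply: none; exists j.
have yT : size y <= 2 ^ (R * v) := leq_trans (output_le compute) tT.
case: Sy; apply: eq_from_onth => j; case: (leqP j (2 ^ (R * v))) => [/same //|jT].
have Sy' : size S <= size y by rewrite -onthNE same // onth_default.
by rewrite !onth_default //; lia.
Qed.

Lemma missed_j0 : missed M K q R b n j0.
Proof.
pose l := [seq j <- mkseq id (2 ^ (R * v)).+1 | missed M K q R b n j].
have lP : last 0 l \in l.
  have [j jT mj] := missed_exists.
  have : j \in l by rewrite mem_filter mj /mkseq map_id mem_iota.
  by case: (l) => // a l' _ /=; rewrite mem_last.
move: lP; rewrite mem_filter /mkseq map_id mem_iota => /and3P[m _ lT].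
suff -> : j0 = last 0 l by [].
by rewrite (word_words capture) //; exact: leq_ltn_trans TltW.
Qed.

Lemma dispute_round i : i < R -> has (wrong M K p q R L b n i) (grid B D 0) ->
  let da := first (wrong M K p q R L b n i) (grid B D 0) in
  [/\ da.1 < D, da.2 < B, wrong M K p q R L b n i da,
   digit L v b i.+1 = da.1 /\ minn (word W b (5 + 2 * i) 1) B.-1 = da.2 &
   forall m a, m < da.1 -> a < B -> ~~ wrong M K p q R L b n i (m, a)].
Proof.
move=> iR hw da; have [w g before] := first_grid (leq0n _) hw.
move: g; rewrite -/da (surjective_pairing da) mem_grid // andbF orbF => /andP[dD aB].
have D' : dispute M K p q R L b n (3 + 2 * i) = [:: da.1; da.2].
  by rewrite /dispute (_ : (3 + 2 * i)./2 = i.+1) //; lia.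
have e5 : 3 + 2 * i.+1 = 5 + 2 * i by lia.
have H := honest iR; rewrite D' in H.
split=> //; rewrite /digit e5 !(word_words H) //=.
- by split; lia.
- by apply: ltn_trans BltW.
- by apply: ltn_trans DltW.
Qed.

Lemma claims_invariant i : i <= R ->
  (forall a, a < B -> claimed (lo i) a = V (pos i * period i) a) /\
  (exists a, [/\ a < B, claimed (hi i) a != V ((pos i).+1 * period i) a &
     0 < i -> a = minn (word W b (3 + 2 * i) 1) B.-1]).
Proof.
elim: i => [_|i IH iR].
  split=> [a _|]; first exact: claimed_init.
  (* The first wrong cell is the captured symbol of the last configuration, read off the proposed
     solution. *)
  exists 4; split=> //; first by lia.
  by rewrite mul1n period0 /claimed /claim /= !eqxx /= eq_sym; exact: missed_j0.
have {IH}[IHl [a0 [a0B IHh _]]] := IH (ltnW iR).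
have D_gt0 : 0 < D by rewrite expn_gt0.
have hw : has (wrong M K p q R L b n i) (grid B D 0).
  (* The search cannot fail: the last of the new intervals ends at [hi i], whose cell [a0] is known
     to be wrong whatever the prover has just written. *)
  apply/hasP; exists (D.-1, a0).
    by rewrite mem_grid // a0B prednK ?leqnn.
  rewrite /wrong /right_end /= prednK // eqxx /truth -mulSnr.
  by rewrite -mulnA -period_step.
have := dispute_round iR hw; set da := first _ _.
move=> [dD aB w [dE aE] before].
have e4 : 2 + 2 * i.+1 = 4 + 2 * i by lia.
split.
  move=> a aB' /=; rewrite dE e4; case: eqP => [->|/eqP d0].
    by rewrite addn0 IHl // period_step // mulnA.
  have := before da.1.-1 a; rewrite prednK ?lt0n // leqnn => /(_ isT aB').
  rewrite /wrong /right_end /= prednK ?lt0n // ifN; last by rewrite ltn_eqF.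
  by rewrite negbK e4 => /eqP ->.
exists da.2; split=> //; last by move=> _; rewrite -aE; congr (minn (word _ _ _ _) _); lia.
by move: w; rewrite /wrong /right_end /= dE /truth [_ * _ + _.+1]addnS.
Qed.

Lemma honest_inconsistent : ~~ consistent M K p q R L b n.
Proof.
have [hl [a [aB hh aE]]] := claims_invariant (leqnn R).
have {}aE : a = address K p q R L b n := aE R_gt0.
rewrite /consistent -aE (step_claimed (i := pos R * period R)) //.
by move: hh; rewrite period_last !muln1.
Qed.

End Honest_challenger.
End Core.

(** * The game *)

Section Play.
Variables (P C : strategy) (x S : seq bool).

Lemma size_play i : size (play P C x S i) = i.
Proof. by elim: i => //= i IH; rewrite size_rcons IH. Qed.

Lemma take_play i k : k <= i -> take k (play P C x S i) = play P C x S k.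
Proof.
elim: i k => [|i IH] k; first by rewrite leqn0 => /eqP ->.
rewrite leq_eqVlt => /predU1P[->|]; first by rewrite take_oversize // size_play.
rewrite ltnS => ki; rewrite -[RHS](IH k ki) /= -cats1 takel_cat // size_play //.
Qed.

Lemma nth_play i k : k < i -> nth [::] (play P C x S i) k =
  (if mover k is Prover then P else C) x S (play P C x S k).
Proof.
move=> ki; rewrite -(nth_take _ (ltnSn k)) take_play //= nth_rcons size_play.
by rewrite ltnn eqxx; case: mover.
Qed.

Lemma same_upto_play i k : k <= i ->
  same_upto (board_of x S (play P C x S k)) (board_of x S (play P C x S i)) k.+2.
Proof.
by move=> ki [|[|e]] //= ek; rewrite -(take_play ki) nth_take.
Qed.

End Play.

Section Game.
Variables (M : TM) (K p q R L : nat).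
Local Notation v := (scale K q).

Definition vote (x S : seq bool) (msgs : seq (seq bool)) : option player :=
  if size msgs == 2 * R.+1 then
    Some (if consistent M K p q R L (board_of x S msgs) (size x)
          then Prover else Challenger)
  else None.

Definition dispute_game : game :=
  MkGame (fun=> R.+1)
    (fun n => (2 ^ v n).+1 * 2 ^ (p * v n) * (L * v n)) vote.

Definition prover : strategy := fun x S msgs =>
  words (L * v (size x)) (claims M K p q R L (board_of x S msgs) (size x)
    (size msgs)./2.-1).

Definition challenger : strategy := fun x S msgs =>
  words (L * v (size x)) (dispute M K p q R L (board_of x S msgs) (size x)
    (size msgs)).

Lemma winner_vote x S msgs : size msgs = 2 * R.+1 ->
  winner dispute_game x S msgs = vote x S msgs.
Proof.
move=> sz; rewrite /winner sz.
have -> : iota 1 (2 * R.+1) = iota 1 (2 * R).+1 ++ [:: 2 * R.+1].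
  by rewrite (_ : 2 * R.+1 = (2 * R).+1 + 1) ?iotaD ?addn1 //; lia.
rewrite pmap_cat.
set l := pmap _ (iota 1 _); have -> : l = [::].
  rewrite {}/l; have : all (fun i => i < 2 * R.+1) (iota 1 (2 * R).+1).
    by apply/allP => i; rewrite mem_iota; lia.
  elim: (iota _ _) => //= i l IH /andP[iR /IH ->].
  rewrite /= /vote size_take sz ifN //; case: ifP => h; lia.
by rewrite /= take_oversize ?sz // /vote sz eqxx.
Qed.

Lemma legal_prover : legal_strategy dispute_game prover.
Proof. by move=> x S msgs; rewrite /prover size_words size_rows. Qed.

Hypotheses (K_gt0 : 0 < K) (q_gt0 : 0 < q) (R_gt0 : 0 < R).
Hypothesis pRL : p + R < L.

Lemma scale_gt0 n : 0 < v n.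
Proof. by rewrite addn_gt0 K_gt0. Qed.

Lemma legal_challenger : legal_strategy dispute_game challenger.
Proof.
move=> x S msgs; rewrite /challenger size_words /= leq_mul2r; apply/orP; right.
have -> : size (dispute M K p q R L (board_of x S msgs) (size x) (size msgs)) = 2.
  by rewrite /dispute; case: ifP.
apply: leq_trans (leq_pmulr _ _); last by rewrite expn_gt0.
by rewrite ltnS expn_gt0.
Qed.

Lemma pos_lt b v' i : pos L v' b i < (2 ^ v') ^ i.
Proof.
elim: i => //= i IH; rewrite expnSr.
apply: (@leq_trans ((pos L v' b i).+1 * 2 ^ v')); last by rewrite leq_mul2r IH orbT.
by rewrite mulSn addnC ltn_add2r digit_lt.
Qed.

Lemma period_le v' i : period R v' i <= 2 ^ (R * v').
Proof. exact: leq_div. Qed.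

Variables (f : puzzle) (t s : nat -> nat).
Hypothesis compute : forall x, tm_computes M x (f x) (t (size x)) (s (size x)).
Hypothesis tT : forall n, t n <= 2 ^ (R * v n).
Hypothesis sB : forall n, 5 + s n <= 2 ^ (p * v n).
Hypothesis stW : forall n, size (states M) <= 2 ^ (L * v n).
Hypothesis syW : forall n, size (symbols M) <= 2 ^ (L * v n).
Hypothesis nW : forall n, n.+2 < 2 ^ (L * v n).

Lemma outcome_vote P C x S :
  outcome dispute_game P C x S = vote x S (play P C x S (2 * R.+1)).
Proof. by rewrite /outcome winner_vote // size_play. Qed.

Lemma prover_wins x S : correct f x S -> prover_wins_with dispute_game prover x S.
Proof.
move=> Sf C _; rewrite outcome_vote /vote size_play eqxx.
rewrite (@honest_consistent M K p q R L x S (f x) _ _ _ (compute x)) // ?scale_gt0 //.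
move=> i iR; have iN : 2 + 2 * i < 2 * R.+1 by lia.
rewrite -[LHS]/(nth [::] (play prover C x S (2 * R.+1)) (2 + 2 * i)).
have mv : mover (2 + 2 * i) = Prover by rewrite /mover oddD mul2n odd_double.
rewrite nth_play // mv /prover size_play.
have -> : (2 + 2 * i)./2.-1 = i by lia.
congr words; apply: claims_same; apply: same_upto_le (same_upto_play _ _ _ _ _); lia.
Qed.

Lemma challenger_wins x S : ~ correct f x S ->
  challenger_wins_with dispute_game challenger x S.
Proof.
move=> Sf P _; rewrite outcome_vote /vote size_play eqxx.
rewrite ifN //.
apply: (@honest_inconsistent M K p q R L x S (f x) _ _ _ (compute x)) => //;
  rewrite ?scale_gt0 //.
- rewrite -[LHS]/(nth [::] (play P challenger x S (2 * R.+1)) 1) nth_play ?mulnS //.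
- move=> i iR; have iN : 3 + 2 * i < 2 * R.+1 by lia.
  rewrite -[LHS]/(nth [::] (play P challenger x S (2 * R.+1)) (3 + 2 * i)).
  have mv : mover (3 + 2 * i) = Challenger by rewrite /mover oddD mul2n odd_double.
  rewrite nth_play // mv /challenger size_play.
  congr words; apply: dispute_same; apply: same_upto_le (same_upto_play _ _ _ _ _); lia.
Qed.

Section Time.
Variables (x S : seq bool) (msgs : seq (seq bool)).
Hypothesis legal_msgs : legal dispute_game (size x) msgs.
Local Notation w := (v (size x)).

Lemma rounds_le : (size msgs)./2.-1 <= R.
Proof. by case: legal_msgs => /=; lia. Qed.

Lemma mul_scale_le k : k <= L -> k * w <= L * w.
Proof. by move=> kL; rewrite leq_mul2r kL orbT. Qed.

Lemma exp_scale_lt k : k < L -> 2 ^ (k * w) < 2 ^ (L * w).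
Proof. by move=> kL; rewrite ltn_exp2l // ltn_pmul2r ?scale_gt0. Qed.

Lemma scale_le_exp k : k <= L -> k * w <= 2 ^ (L * w).
Proof.
move=> kL; apply: leq_trans (mul_scale_le kL) _.
by apply: ltnW; exact: ltn_expl.
Qed.

Lemma pos_mul_le b : pos L w b (size msgs)./2.-1 * 2 ^ w <= 2 ^ (L * w).
Proof.
apply: (@leq_trans ((2 ^ w) ^ (size msgs)./2.-1.+1)).
  by rewrite expnSr leq_mul2r (ltnW (pos_lt _ _ _)) orbT.
rewrite -expnM leq_exp2l // mulnC leq_mul2r; apply/orP; right.
by have := rounds_le; lia.
Qed.

Lemma rounds_le_scale : (size msgs)./2.-1 <= L * w.
Proof.
apply: leq_trans rounds_le _; apply: leq_trans (leq_pmulr _ (scale_gt0 (size x))).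
by lia.
Qed.

Lemma prover_time : exists tm,
  ram_computes (PROVER M K p q R L) x S msgs (prover x S msgs) tm /\
  tm <= pcost (2 ^ (L * w)) (PROVER M K p q R L).
Proof.
suff : wp (2 ^ (L * w)) (board_of x S msgs) (PROVER M K p q R L)
    (ram_init x msgs) (fun s' => ram_out s' = prover x S msgs).
  by move=> [tm [s' [ex le e]]]; exists tm; split=> //; exists s'.
apply: (@wp_PROVER M K p q R L q_gt0 _ _ (size x) _ (size msgs)) => //.
- exact: scale_le_exp.
- by apply: scale_le_exp; lia.
- by apply: scale_le_exp; lia.
- by rewrite -{1}(mul1n w); apply: scale_le_exp; lia.
- by apply: leq_trans rounds_le_scale _; exact: scale_le_exp.
- by rewrite -{1}(mul1n w); apply: exp_scale_lt; lia.
- by apply/ltnW/exp_scale_lt; lia.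
- exact: pos_mul_le.
- by apply: leq_trans (period_le _ _) _; apply/ltnW/exp_scale_lt; lia.
Qed.

Lemma challenger_time : exists tm,
  ram_computes (CHALLENGER M K p q R L) x S msgs (challenger x S msgs) tm /\
  tm <= pcost (2 ^ (L * w)) (CHALLENGER M K p q R L).
Proof.
suff : wp (2 ^ (L * w)) (board_of x S msgs) (CHALLENGER M K p q R L)
    (ram_init x msgs) (fun s' => ram_out s' = challenger x S msgs).
  by move=> [tm [s' [ex le e]]]; exists tm; split=> //; exists s'.
apply: (@wp_CHALLENGER M K p q R L q_gt0 _ _ (size x) _ (size msgs)) => //.
- exact: scale_le_exp.
- by apply: scale_le_exp; lia.
- by apply: scale_le_exp; lia.
- by rewrite -{1}(mul1n w); apply: scale_le_exp; lia.
- by apply: leq_trans rounds_le_scale _; exact: scale_le_exp.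
- by apply: ltnW; rewrite -{1}(mul1n w); apply: exp_scale_lt; lia.
- by apply/ltnW/exp_scale_lt; lia.
- by apply: exp_scale_lt; lia.
- exact: pos_mul_le.
- by apply: leq_trans (period_le _ _) _; apply/ltnW/exp_scale_lt; lia.
- move=> j a aB; apply: (@conf_blank M x) (compute x) _ _ _ => //.
  exact: leq_trans (sB _) aB.
Qed.

(** All loops of the miner run over the rounds, the bits of a word or an exponent of 2, hence the
    bound [L * w]; its single simulated step contains no loop. *)
Lemma miner_cost : exists tm,
  ram_computes (MINER M K p q R L) x S msgs
    (encode_verdict (vg_verdict dispute_game x S msgs)) tm /\
  tm <= pcost (L * w) (MINER M K p q R L).
Proof.
suff : wp (L * w) (board_of x S msgs) (MINER M K p q R L) (ram_init x msgs)
    (fun s' => ram_out s' = encode_verdict (vg_verdict dispute_game x S msgs)).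
  by move=> [tm [s' [ex le e]]]; exists tm; split=> //; exists s'.
apply: (@wp_MINER M K p q R L q_gt0 _ _ (size x) _ (size msgs)) => //.
- by apply: mul_scale_le; lia.
- by apply: mul_scale_le; lia.
- by rewrite -{1}(mul1n w); apply: mul_scale_le; lia.
- exact: rounds_le_scale.
- move=> s' ->; rewrite /= /vote; case: ifP => // _.
  by case: consistent.
Qed.

End Time.
End Game.

(** * Asymptotics *)

Local Open Scope ring_scope.

Section Asymptotics.
Variable R : realType.

(** The game must work for every [n]. The finitely many exceptional values are summed into [C], and
    the 1 is needed where [g] vanishes. *)
Lemma isO_bound (f : nat -> nat) (g : nat -> R) : isO f g ->
  exists C : nat, forall n, (f n)%:R <= C%:R * (1 + `|g n|).
Proof.
move=> /eqO_exP [k k0 [N _ kN]].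
exists ((Num.trunc k).+1 + \sum_(i < N) f i)%N => n.
have g0 : 0 <= `|g n| := normr_ge0 _.
have kS := ltW (truncnS_gt k).
rewrite natrD mulrDl !mulrDr !mulr1.
set a := _.+1%:R in kS *; set S := (\sum_(i < N) f i)%:R.
have a0 : 0 <= a by rewrite ler0n.
have S0 : 0 <= S by rewrite ler0n.
have ag : k * `|g n| <= a * `|g n| by rewrite ler_wpM2r.
have Sg : 0 <= S * `|g n| by rewrite mulr_ge0.
have ag0 : 0 <= a * `|g n| by rewrite mulr_ge0.
have [Nn|nN] := leqP N n.
  by have := kN n Nn; rewrite normr_nat; lra.
suff : (f n)%:R <= S by lra.
by rewrite ler_nat (bigD1 (Ordinal nN)) //= leq_addr.
Qed.

Lemma bound_isO (f : nat -> nat) (g : nat -> R) (C : R) : 0 < C ->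
  (forall n, (0 < n)%N -> (f n)%:R <= C * `|g n|) -> isO f g.
Proof.
move=> C0 H; apply/eqO_exP; exists C => //; exists 1%N => // n n1.
by rewrite normr_nat; exact: H.
Qed.

Lemma poly_pcost (p : prog) (z : {poly R}) : exists u : {poly R},
  forall (Z : nat) (y : R), Z%:R <= z.[y] -> (pcost Z p)%:R <= u.[y].
Proof.
have [C [d H]] := pcost_poly p; exists (C%:R *: (z + 1) ^+ d) => Z y Zz.
rewrite hornerZ horner_exp hornerD hornerC.
apply: (@le_trans _ _ (C%:R * Z.+1%:R ^+ d)).
  by rewrite -natrX -natrM ler_nat.
apply: ler_wpM2l => //; apply: lerXn2r; rewrite ?nnegrE //.
  by rewrite addr_ge0 // (le_trans _ Zz).
by rewrite -natr1 lerD2r.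
Qed.

Variable q : nat.
Hypothesis q_gt0 : (0 < q)%N.

Lemma base_gt1 : (1 < 2 ^ q)%N.
Proof. by rewrite -(expn0 2) ltn_exp2l. Qed.

Local Notation ell n := (up_log (2 ^ q) n.+1).

Lemma lt_exp_ell n : (n < 2 ^ (q * ell n))%N.
Proof. by rewrite expnM; exact: up_logP base_gt1. Qed.

Lemma exp_ell_le n : (0 < n)%N -> ((2 ^ q) ^ (ell n).-1 <= n)%N.
Proof. by move=> n0; rewrite -ltnS; exact: up_log_gtn base_gt1 _. Qed.

Lemma ell0 : ell 0 = 0%N.
Proof. by rewrite up_log1. Qed.

Lemma exp2_ell_le n : (2 ^ ell n <= 2 * n.+1)%N.
Proof.
case: n => [|n]; first by rewrite ell0.
have l0 : (0 < ell n.+1)%N by rewrite up_log_gt0 base_gt1.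
rewrite -(prednK l0) expnS leq_mul2l; apply: leqW.
apply: leq_trans (exp_ell_le (ltn0Sn n)).
by rewrite -expnM leq_exp2l // leq_pmull.
Qed.

Lemma ell_ln n : (ell n)%:R <= 1 + ln n%:R / ln 2 :> R.
Proof.
have ln2 : 0 < ln 2 :> R by rewrite ln_gt0 // ltr1n.
(* The conventional value 0 of the logarithm at 0 agrees with [ell 0 = 0]. *)
case: n => [|n]; first by rewrite ell0 ln0 // mul0r addr0.
have l0 : (0 < ell n.+1)%N by rewrite up_log_gt0 base_gt1.
have h : (2 ^ (ell n.+1).-1 <= n.+1)%N.
  apply: leq_trans (exp_ell_le (ltn0Sn n)).
  by rewrite -expnM leq_exp2l // leq_pmull.
rewrite -(prednK l0) -natr1 addrC lerD2l ler_pdivlMr //.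
rewrite mulr_natl -lnXn // ler_ln ?posrE ?exprn_gt0 ?ltr0n //.
by rewrite -natrX ler_nat.
Qed.

Lemma pcost_exp_scale (K L : nat) (p : prog) : exists u : {poly R}, forall n,
  (pcost (2 ^ (L * scale K q n)) p)%:R <= u.[n%:R].
Proof.
have [u H] := poly_pcost p (((2 ^ K.+1)%:R *: ('X + 1)) ^+ L).
exists u => n; apply: H.
rewrite horner_exp hornerZ hornerD hornerX hornerC natr1 -natrM -natrX ler_nat.
rewrite mulnC expnM; case: (posnP L) => [->|L0]; first by rewrite !expn0.
rewrite leq_exp2r // /scale expnD expnSr -mulnA leq_mul2l.
by rewrite exp2_ell_le orbT.
Qed.

Lemma pcost_scale (K L : nat) (p : prog) : exists u : {poly R}, forall n,
  (pcost (L * scale K q n) p)%:R <= u.[ln n%:R].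
Proof.
have [u H] := poly_pcost p (L%:R *: ((K%:R + 1)%:P + (ln 2)^-1 *: 'X)).
exists u => n; apply: H.
rewrite hornerZ hornerD hornerC hornerZ hornerX natrM ler_wpM2l // natrD.
by rewrite -addrA lerD2l mulrC; exact: ell_ln.
Qed.

Lemma exp2_powR (m : nat) : (2 ^ m)%:R = 2 `^ m%:R :> R.
Proof. by rewrite powR_mulrn // natrX. Qed.

Lemma isO_exp_ell (f : nat -> nat) (e : R) (m : nat) : 0 <= e ->
  e * q%:R <= m%:R -> isO f (fun n : nat => n%:R `^ e) ->
  exists C : nat, forall n, (f n <= C * 2 ^ (m * ell n))%N.
Proof.
move=> e0 em /isO_bound[C HC]; exists (C * 2)%N => n.
rewrite -(ler_nat R); apply: le_trans (HC n) _.
rewrite -mulnA natrM ler_wpM2l // ger0_norm ?powR_ge0 // natrM mulr_natl mulr2n.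
rewrite lerD //; first by rewrite ler1n expn_gt0.
apply: (@le_trans _ _ ((2 ^ (q * ell n))%:R `^ e)).
  by apply: ge0_ler_powR; rewrite ?nnegrE // ler_nat ltnW // lt_exp_ell.
rewrite !exp2_powR -powRrM; apply: ler_powR; first by rewrite ler1n.
by rewrite !natrM mulrAC (mulrC q%:R) ler_wpM2r.
Qed.

(** [ell n] exceeds a lower bound for the logarithm to base [2 ^ q] by one; this rounding is paid
    for by the constant [2 ^ m]. *)
Lemma exp_ell_powR (e : R) (m n : nat) : 0 <= e -> m%:R <= e * q%:R -> (0 < n)%N ->
  (2 ^ (m * ell n))%:R <= (2 ^ m)%:R * n%:R `^ e.
Proof.
move=> e0 me n0; have l0 : (0 < ell n)%N by rewrite up_log_gt0 base_gt1.
rewrite -{1}(prednK l0) mulnS expnD natrM ler_wpM2l //.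
apply: (@le_trans _ _ (((2 ^ q) ^ (ell n).-1)%:R `^ e)); last first.
  by apply: ge0_ler_powR; rewrite ?nnegrE // ler_nat exp_ell_le.
rewrite -expnM !exp2_powR -powRrM; apply: ler_powR; first by rewrite ler1n.
by rewrite !natrM mulrAC (mulrC q%:R) ler_wpM2r.
Qed.

Lemma limit_isO (K L p : nat) (e : R) : 0 <= e -> (p + 2)%:R <= e * q%:R ->
  isO (fun n => (2 ^ scale K q n).+1 * 2 ^ (p * scale K q n) * (L * scale K q n))%N
    (fun n : nat => n%:R `^ e).
Proof.
move=> e0 pe.
apply: (@bound_isO _ _ (2 * L * 2 ^ ((p + 2) * K) * 2 ^ (p + 2)).+1%:R) => // n n0.
rewrite ger0_norm ?powR_ge0 //.
have lim w : ((2 ^ w).+1 * 2 ^ (p * w) * (L * w) <= 2 * L * 2 ^ ((p + 2) * w))%N.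
  have -> : ((p + 2) * w = w + p * w + w)%N by lia.
  have w2 : (w <= 2 ^ w)%N by apply/ltnW/ltn_expl.
  have w1 : (0 < 2 ^ w)%N by rewrite expn_gt0.
  rewrite !expnD [leqRHS](_ : _ = (2 * 2 ^ w) * 2 ^ (p * w) * (L * 2 ^ w))%N; last by ring.
  by rewrite !leq_mul //; lia.
apply: (@le_trans _ _ (2 * L * 2 ^ ((p + 2) * scale K q n))%:R).
  by rewrite ler_nat lim.
rewrite /scale mulnDr expnD mulnA natrM.
have h := exp_ell_powR e0 pe n0.
apply: le_trans (ler_wpM2l _ h) _ => //.
rewrite mulrA -natrM ler_wpM2r ?powR_ge0 // ler_nat; lia.
Qed.

End Asymptotics.

(** * Assembling the game and choosing its parameters *)

Lemma dispute_verification_game (R : realType) (f : puzzle) (M : TM)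
    (t s : nat -> nat) (K p q r L : nat) (e : R) :
  (0 < K)%N -> (0 < q)%N -> (0 < r)%N -> (p + r < L)%N ->
  (forall x, tm_computes M x (f x) (t (size x)) (s (size x))) ->
  (forall n, t n <= 2 ^ (r * scale K q n))%N ->
  (forall n, 5 + s n <= 2 ^ (p * scale K q n))%N ->
  (forall n, size (states M) <= 2 ^ (L * scale K q n))%N ->
  (forall n, size (symbols M) <= 2 ^ (L * scale K q n))%N ->
  (forall n, n.+2 < 2 ^ (L * scale K q n))%N ->
  0 <= e -> (p + 2)%:R <= e * q%:R ->
  FGH_verification_game f (fun=> r.+1) (fun n : nat => n%:R `^ e)
    (fun n : nat => ln n%:R) (dispute_game M K p q r L).
Proof.
move=> K0 q0 r0 prL comp tT sB stW syW nW e0 pe; split=> //; last first.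
- have [u H] := pcost_scale R q0 K L (MINER M K p q r L).
  exists (MINER M K p q r L), u => x S msgs lm _.
  have [tm [ex le]] := miner_cost K0 q0 r0 prL S lm.
  by exists tm; split=> //; apply: le_trans (H _); rewrite ler_nat.
- exact: limit_isO.
split.
  move=> x S msgs _ sz; by rewrite winner_vote // /vote sz eqxx.
exists (prover M K p q r L), (challenger M K p q r L); split.
- split; first exact: legal_prover.
  have [u H] := pcost_exp_scale R q0 K L (PROVER M K p q r L).
  exists (PROVER M K p q r L), u => x S msgs lm _.
  have [tm [ex le]] := prover_time K0 q0 r0 prL S lm.
  by exists tm; split=> //; apply: le_trans (H _); rewrite ler_nat.
- split; first exact: legal_challenger.
  have [u H] := pcost_exp_scale R q0 K L (CHALLENGER M K p q r L).
  exists (CHALLENGER M K p q r L), u => x S msgs lm _.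
  have [tm [ex le]] := challenger_time K0 q0 r0 prL comp sB S lm.
  by exists tm; split=> //; apply: le_trans (H _); rewrite ler_nat.
- by move=> x S; apply: (prover_wins K0 q0 r0 prL comp).
- by move=> x S; apply: (challenger_wins K0 q0 r0 prL comp).
Qed.

(** As [K] is added inside the exponents, a factor [2 ^ K] is gained in every bound at once; since
    [K < 2 ^ K], it absorbs all constants for every [n]. *)
Lemma exists_scale (p q r A C C' : nat) (t s : nat -> nat) :
  (0 < p)%N -> (0 < q)%N -> (0 < r)%N ->
  (forall n, t n <= C * 2 ^ (r * up_log (2 ^ q) n.+1))%N ->
  (forall n, s n <= C' * 2 ^ (p * up_log (2 ^ q) n.+1))%N ->
  exists2 K, (0 < K)%N & forall n,
    [/\ (t n <= 2 ^ (r * scale K q n))%N, (5 + s n <= 2 ^ (p * scale K q n))%N,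
        (A <= 2 ^ ((p + r + q + 1) * scale K q n))%N &
        (n.+2 < 2 ^ ((p + r + q + 1) * scale K q n))%N].
Proof.
(* The 5 serves twice: for the header cells of a configuration, and for [n.+2 < 5 * 2 ^ (q * l)]. *)
move=> p0 q0 r0 HC HC'; pose K := (C + C' + A + 5)%N.
have KK : (K < 2 ^ K)%N by exact: ltn_expl.
exists K => [|n]; first by rewrite addn_gt0 orbT.
set l := up_log (2 ^ q) n.+1.
have expK m : (0 < m)%N -> (2 ^ K * 2 ^ (m * l) <= 2 ^ (m * scale K q n))%N.
  move=> m0; rewrite /scale mulnDr expnD leq_mul2r leq_exp2l //.
  by rewrite leq_pmull ?orbT.
have expKl c m : (0 < m)%N -> (c <= K)%N ->
    (c * 2 ^ (m * l) <= 2 ^ (m * scale K q n))%N.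
  move=> m0 cK; apply: leq_trans (expK m m0).
  by rewrite leq_mul2r (leq_trans cK (ltnW KK)) orbT.
have expL m : (m <= p + r + q + 1)%N ->
    (2 ^ (m * scale K q n) <= 2 ^ ((p + r + q + 1) * scale K q n))%N.
  by move=> mL; rewrite leq_exp2l // leq_mul2r mL orbT.
have l1 m : (0 < 2 ^ (m * l))%N by rewrite expn_gt0.
split.
- by apply: leq_trans (HC n) (expKl _ _ r0 _); rewrite /K; lia.
- apply: leq_trans (expKl (5 + C')%N _ p0 _); last by rewrite /K; lia.
  by rewrite mulnDl leq_add ?HC' // leq_pmulr.
- apply: leq_trans (expL q _); last by lia.
  by apply: leq_trans (expKl A _ q0 _); [rewrite leq_pmulr|rewrite /K; lia].
- apply: leq_trans (expL q _); last by lia.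
  apply: leq_trans (expKl 5 _ q0 _); last by rewrite /K; lia.
  by have := lt_exp_ell q0 n; rewrite -/l; have := l1 q; lia.
Qed.

Theorem proposition9 (R : realType) (eps : rat) (k h : R)
    (eps_gt0 : 0 < eps) (k_gt0 : 0 < k) (h_gt0 : 0 < h) :
  exists c : nat, forall f : puzzle,
    solvable f (fun n : nat => n%:R `^ k) (fun n : nat => n%:R `^ h) ->
    exists (F : nat -> nat) (g : game),
      (forall n : nat, (F n <= c)%N) /\
      FGH_verification_game f F
        (fun n : nat => n%:R `^ (h + ratr eps)) (fun n : nat => ln n%:R) g.
Proof.
have e_gt0 : 0 < ratr eps :> R by rewrite ltr0q.
set e : R := ratr eps in e_gt0 *.
pose q := (Num.trunc (3 / e)).+1.
have q3 : 3 <= e * q%:R by rewrite mulrC -ler_pdivrMr // ltW // truncnS_gt.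
pose p := (Num.trunc (h * q%:R)).+1.
have hq0 : 0 <= h * q%:R by rewrite mulr_ge0 // ltW.
have /andP[hp ph] : (Num.trunc (h * q%:R))%:R <= h * q%:R < p%:R := truncn_itv hq0.
(* Each of [r] subdivisions gains a factor of order [n ^ (1 / q)], so r >= k * q of them exhaust
   time [n ^ k]. *)
pose r := (q * (Num.trunc k).+1)%N.
have kr : k * q%:R <= r%:R.
  by rewrite natrM mulrC ler_wpM2l // ltW // truncnS_gt.
(* The bound is fixed before [f]: the constants of the machine go into [K], which does not affect
   the number of rounds. *)
exists r.+1 => f [M [t [s [tO sO comp]]]].
have q0 : (0 < q)%N by [].
have [C HC] := isO_exp_ell q0 (ltW k_gt0) kr tO.
have [C' HC'] := isO_exp_ell q0 (ltW h_gt0) (ltW ph) sO.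
have r0 : (0 < r)%N by rewrite muln_gt0.
have [K K0 HK] := exists_scale (size (states M) + size (symbols M))
  (ltn0Sn _ : (0 < p)%N) q0 r0 HC HC'.
have e_p : (p + 2)%:R <= (h + e) * q%:R.
  have -> : (p + 2)%:R = (Num.trunc (h * q%:R))%:R + 3 :> R.
    by rewrite -natrD addn2 addn3.
  by rewrite mulrDl lerD.
(* In the word length, [p] accounts for addresses, [r] for times, [q] for positions on the input,
   and 1 for strictness. *)
exists (fun=> r.+1), (dispute_game M K p q r (p + r + q + 1)); split=> //.
apply: (dispute_verification_game (t := t) (s := s)) => //.
- by rewrite addn1 ltnS leq_addr.
- by move=> n; have [] := HK n.
- by move=> n; have [] := HK n.
- by move=> n; have [_ _ h' _] := HK n; exact: leq_trans (leq_addr _ _) h'.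
- by move=> n; have [_ _ h' _] := HK n; exact: leq_trans (leq_addl _ _) h'.
- by move=> n; have [] := HK n.
- by rewrite addr_ge0 // ltW.
Qed.
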